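(* Assume $X$ has infinite variation, i.e. $\sigma\neq0$ or $\int_{|x|\le1}|x|\nu(dx)=\infty$, and that $d_+\ge0$. Then $$\lim_{t\to T}\frac{1}{T-t}\Big(\frac{K}{b(t)}-1\Big)=+\infty.$$
   Context: Let $X$ be a real Lévy process with characteristic triplet $(\sigma^2,\gamma,\nu)$; $(\mathcal F_t)$ the usual augmentation of its natural filtration. Fix $T>0$, $K>0$, $r>0$, $\delta\ge0$. Assume $\int_{|x|\ge1}e^x\nu(dx)<\infty$ and $\frac{\sigma^2}{2}+\gamma+\int(e^x-1-x\mathbf 1_{|x|\le1})\nu(dx)=0$, and the non-degeneracy condition: $\sigma\neq0$, or $\nu((-\infty,0))>0$, or $\int_{(0,\infty)}(x\wedge1)\nu(dx)=\infty$. For $x\ge0$ let $S^x_t=xe^{(r-\delta)t+X_t}$; $P(t,x)=\sup_{\tau\in\mathcal T_{0,T-t}}\mathbb E[e^{-r\tau}(K-S^x_\tau)_+]$ (American put, $\mathcal T_{0,s}$ = stopping times in $[0,s]$), and $b(t)=\inf\{x\ge0:P(t,x)>(K-x)_+\}$, $t\in[0,T)$, its critical price. Let $d_+=r-\delta-\int(e^y-1)_+\nu(dy)$. *)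

(* Defs.v *)
From HB Require Import structures.
From mathcomp Require Import all_boot all_order all_algebra.
From mathcomp Require Import all_classical all_reals all_analysis.
Set Implicit Arguments. Unset Strict Implicit. Unset Printing Implicit Defensive.
Import Order.TTheory GRing.Theory Num.Theory.
Import numFieldNormedType.Exports.
Local Open Scope ring_scope.
Local Open Scope classical_set_scope.

Section LevyAmericanPut.
Context {R : realType} {d : measure_display} {Omega : measurableType d}.
Variable P : probability Omega R.
Implicit Types (X : R -> Omega -> R).

Definition complete_probability :=
  forall N A : set Omega, measurable N -> P N = 0%E -> A `<=` N -> measurable A.

Definition increment X (s t : R) : Omega -> R := fun w => X t w - X s w.

Definition independent_increments X :=
  forall (n : nat) (t : nat -> R) (B : nat -> set R),
    0 <= t 0%N -> (forall i, (i < n)%N -> t i < t i.+1) ->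
    (forall i, measurable (B i)) ->
    P (\bigcap_(i in `I_n) (increment X (t i) (t i.+1) @^-1` B i)) =
    (\prod_(i < n) P (increment X (t i) (t i.+1) @^-1` B i))%E.

Definition stationary_increments X :=
  forall s t : R, 0 <= s -> 0 <= t -> forall B : set R, measurable B ->
    P (increment X s (s + t) @^-1` B) = P (X t @^-1` B).

Definition cadlag (f : R -> R) :=
  (forall t : R, 0 <= t -> f @ t^'+ --> f t) /\
  (forall t : R, 0 < t -> cvg (f @ t^'-)).

Definition levy_process X :=
  [/\ (forall t, measurable_fun setT (X t)),
      {ae P, forall w, X 0 w = 0},
      independent_increments X,
      stationary_increments X &
      {ae P, forall w, cadlag (fun t => X t w)}].

Definition levy_measure (nu : {measure set R -> \bar R}) :=
  nu [set 0] = 0%E /\ (\int[nu]_x (Num.min 1 (x ^+ 2))%:E < +oo)%E.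

(** real and imaginary parts of the Levy-Khintchine exponent
    psi(u) = -sigma^2 u^2/2 + i gamma u + int (e^{iux} - 1 - iux 1_{|x|<=1}) nu(dx) *)
Definition psi_re (sigma : R) (nu : {measure set R -> \bar R}) (u : R) : R :=
  - (sigma ^+ 2 * u ^+ 2) / 2 + Rintegral nu setT (fun x => cos (u * x) - 1).
Definition psi_im (gamma : R) (nu : {measure set R -> \bar R}) (u : R) : R :=
  gamma * u +
  Rintegral nu setT (fun x => sin (u * x) - (if `|x| <= 1 then u * x else 0)).

(** X has characteristic triplet (sigma^2, gamma, nu):
    E[e^{iuX_t}] = exp(t psi(u)), written with real and imaginary parts *)
Definition has_triplet X (sigma gamma : R) (nu : {measure set R -> \bar R}) :=
  levy_measure nu /\
  forall t u : R, 0 <= t ->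
    Rintegral P setT (fun w => cos (u * X t w)) =
      expR (t * psi_re sigma nu u) * cos (t * psi_im gamma nu u) /\
    Rintegral P setT (fun w => sin (u * X t w)) =
      expR (t * psi_re sigma nu u) * sin (t * psi_im gamma nu u).

Definition natural_filtration X (u : R) : set (set Omega) :=
  <<s [set A | exists s (B : set R),
          [/\ 0 <= s <= u, measurable B & A = X s @^-1` B]] >>.

Definition null_event (N : set Omega) := measurable N /\ P N = 0%E.

(** usual augmentation: F_t = \bigcap_{u > t} sigma(F^0_u \cup null sets) *)
Definition usual_augmentation X (t : R) : set (set Omega) :=
  [set A | forall u, t < u -> exists B, natural_filtration X u B /\
     exists N, null_event N /\ (A `\` B) `|` (B `\` A) `<=` N].

Definition stopping_time (F : R -> set (set Omega)) (tau : Omega -> R) :=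
  forall t, 0 <= t -> F t [set w | tau w <= t].

Definition stopping_times_upto (F : R -> set (set Omega)) (s : R) :=
  [set tau | stopping_time F tau /\ forall w, 0 <= tau w <= s].

Definition price X (r delta x t : R) (w : Omega) : R :=
  x * expR ((r - delta) * t + X t w).

Definition american_put X (r delta K T t x : R) : \bar R :=
  ereal_sup [set (\int[P]_w
      (expR (- (r * tau w)) * Num.max (K - price X r delta x (tau w) w) 0)%:E)%E
    | tau in stopping_times_upto (usual_augmentation X) (T - t)].

Definition critical_price X (r delta K T t : R) : R :=
  inf [set x : R | 0 <= x /\
        ((Num.max (K - x) 0)%:E < american_put X r delta K T t x)%E].

End LevyAmericanPut.

(* Main.v *)
Require Import Defs.
From HB Require Import structures.
From mathcomp Require Import all_boot all_order all_algebra.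
From mathcomp Require Import all_classical all_reals all_analysis.
From mathcomp Require Import measurable_realfun ring lra.
Import Order.TTheory GRing.Theory Num.Theory.
Import numFieldNormedType.Exports.
Local Open Scope ring_scope.
Local Open Scope classical_set_scope.

(**
Write [theta = T - t].  If [0 < b(t) <= K / (1 + M theta)], the quotient is at
least [M], so both bounds are needed.

Upper bound.  Exercising at maturity shows that [x = K / (1 + M theta)] lies in
the continuation region as soon as [E (1 - e^X_theta)_+ / theta] is large.  The
lacunary sums [f_N y = sum_(k < N) 2^-k (1 - cos (2^k y))] satisfy
[f_N y <= 40 (1 - e^y)_+ + 16 sin y + 24 min(1, y^2)].  The last two terms have
mean [O(theta)], while [E f_N(X_theta)] is read off the characteristic function
and is at least [theta / 2 * sum_(k < N) 2^-k (- Re psi (2^k))] for small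
[theta]; this sum diverges with [N] exactly because of infinite variation.

Lower bound.  Since [1 + sin y - 2 min(1, y^2) <= e^y] and [r >= delta] (a
consequence of [d_+ >= 0]), it suffices to know that [E sin X_tau] and
[E min(1, X_tau^2)] are [O(E tau)] uniformly in the stopping time [tau]: for
small [x] the interest lost on the strike by waiting, of order [K E tau], then
exceeds the gain [x O(E tau)].  These estimates follow from
[|E cos (u X_tau + a) - cos a| <= C_u E tau], proved by discretising [tau] from
the right and using that increments are independent of the past.
*)

(** * Trigonometric bounds *)

Section trigonometric_bounds.
Context {R : realType}.
Implicit Types x y v : R.

(** An instance of the mean value theorem; the comparisons of [sin] with polynomials below apply it
    to the difference of the two sides. *)
Lemma ge0_of_derive_ge0 (f df : R -> R) x : 0 <= x -> f 0 = 0 ->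
  (forall y, is_derive y 1 f (df y)) -> (forall y, 0 <= y <= x -> 0 <= df y) ->
  0 <= f x.
Proof.
move=> x0 f0 fdf df0.
have cf : {within `[0, x], continuous f}.
  apply: continuous_subspaceT => y; apply: differentiable_continuous.
  by apply/derivable1_diffP; case: (fdf y).
have [c] := @MVT_segment R f df 0 x x0 (fun y _ => fdf y) cf.
rewrite in_itv/= f0 !subr0 => cx ->.
by rewrite mulr_ge0// df0.
Qed.

Lemma sin_le_id x : 0 <= x -> sin x <= x.
Proof.
move=> x0; rewrite -subr_ge0.
apply: (@ge0_of_derive_ge0 (fun y => y - sin y) (fun y => 1 - cos y)) => //.
by rewrite sin0 subr0.
Qed.

Lemma norm_sin_le x : `|sin x| <= `|x|.
Proof.
wlog x0 : x / 0 <= x.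
  move=> h; have [/h//|x0] := leP 0 x.
  by rewrite -[x]opprK sinN normrN [`|- - _|]normrN; apply: h; rewrite oppr_ge0 ltW.
rewrite (ger0_norm x0) ler_norml sin_le_id// andbT.
rewrite -subr_ge0 opprK.
apply: (@ge0_of_derive_ge0 (fun y => sin y + y) (fun y => cos y + 1)) => //.
by rewrite sin0 addr0.
Qed.

Lemma onem_cosE x : 1 - cos x = 2 * sin (x / 2) ^+ 2.
Proof.
have -> : cos x = cos ((x / 2) *+ 2) by congr cos; rewrite mulr2n; lra.
rewrite cos_mulr2n cos2sin2 !mulr2n; ring.
Qed.

Lemma onem_cos_le_sqr x : 1 - cos x <= x ^+ 2 / 2.
Proof.
rewrite onem_cosE.
have : sin (x / 2) ^+ 2 <= (x / 2) ^+ 2.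
  by rewrite -[leLHS]real_normK ?num_real// -[leRHS]real_normK ?num_real// lerXn2r ?nnegrE// norm_sin_le.
rewrite exprMn; lra.
Qed.

Lemma onem_cos_ge0 x : 0 <= 1 - cos x.
Proof. by rewrite subr_ge0 cos_le1. Qed.

Lemma onem_cos_le2 x : 1 - cos x <= 2.
Proof. by have := cos_geN1 x; lra. Qed.

Lemma onem_cos_le_norm x : 1 - cos x <= `|x|.
Proof.
rewrite onem_cosE.
have h := norm_sin_le (x / 2); have h1 := sin_max (x / 2).
have -> : `|x| = 2 * `|x / 2| by rewrite normrM (@ger0_norm _ (2^-1)); lra.
rewrite -[sin _ ^+ _]real_normK ?num_real//.
have := normr_ge0 (sin (x / 2)); nra.
Qed.

Lemma half_le_sin x : 0 <= x <= 1 -> x / 2 <= sin x.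
Proof.
move=> /andP[x0 x1]; rewrite -subr_ge0.
apply: (@ge0_of_derive_ge0 (fun y => sin y - y / 2) (fun y => cos y - 2^-1)) => //.
- by rewrite sin0 mul0r subr0.
- move=> y; have d : is_derive y (1 : R) (fun y : R => y * 2^-1) (2^-1 : R).
    have -> : (fun y : R => y * 2^-1) = 2^-1 *: (id : R -> R).
      by apply/funext => z; rewrite /= mulrC.
    by apply: is_derive_eq; rewrite scaler1.
  exact: is_deriveB.
- move=> y /andP[y0 yx]; have := onem_cos_le_sqr y; nra.
Qed.

Lemma onem_cos_ge_sqr x : `|x| <= 2 -> x ^+ 2 / 8 <= 1 - cos x.
Proof.
move=> x2; rewrite -cos_norm onem_cosE -[x ^+ 2]real_normK ?num_real//.
have : `|x| / 2 / 2 <= sin (`|x| / 2) by apply: half_le_sin; have := normr_ge0 x; lra.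
have := normr_ge0 x; nra.
Qed.

Lemma sub_sin_le_sqr x : 0 <= x -> x - sin x <= x ^+ 2 / 2.
Proof.
move=> x0; rewrite -subr_ge0.
apply: (@ge0_of_derive_ge0 (fun y => y ^+ 2 / 2 - (y - sin y))
   (fun y => y - (1 - cos y))) => //.
- by rewrite sin0 expr2 !mul0r !subr0.
- move=> y; have d : is_derive y (1 : R) (fun y : R => y ^+ 2 / 2) y.
    have -> : (fun y : R => y ^+ 2 * 2^-1) = 2^-1 *: ((id : R -> R) ^+ 2).
      by apply/funext => z; rewrite /= mulrC exprfctE.
    apply: is_derive_eq; rewrite /GRing.scale/= !mulr1 expr1 -mulr_natl; lra.
  exact: is_deriveB.
- move=> y /andP[y0 yx]; have := onem_cos_le_norm y.
  by rewrite (ger0_norm y0) subr_ge0.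
Qed.

Lemma norm_sin_sub_le x : `|sin x - x| <= x ^+ 2 / 2.
Proof.
wlog x0 : x / 0 <= x.
  move=> h; have [/h//|x0] := leP 0 x.
  rewrite -[x]opprK sinN -opprD normrN [(- - _) ^+ 2]sqrrN.
  by apply: h; rewrite oppr_ge0 ltW.
by rewrite distrC ger0_norm ?subr_ge0 ?sin_le_id// sub_sin_le_sqr.
Qed.

(** The two sides differ by [2 (cos x - 1)^2]. *)
Lemma onem_cos_double x : 1 - cos (2 * x) <= 4 * (1 - cos x).
Proof.
have -> : 2 * x = x *+ 2 by rewrite mulr_natl.
rewrite cos_mulr2n mulr2n; have := sqr_ge0 (cos x - 1); nra.
Qed.

Lemma onemexpRN_ge x : 0 <= x -> x / (1 + x) <= 1 - expR (- x).
Proof.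
move=> x0; rewrite expRN.
have h := expR_ge1Dx x.
have : (expR x)^-1 <= (1 + x)^-1 by rewrite lef_pV2 ?posrE ?expR_gt0//; lra.
have -> : x / (1 + x) = 1 - (1 + x)^-1 by field; rewrite lt0r_neq0//; lra.
lra.
Qed.

End trigonometric_bounds.

(** * Test functions *)

Section test_functions.
Context {R : realType}.
Implicit Types x y : R.

(** Partial sums of a Weierstrass-type series. They are uniformly bounded, become comparable to
    [|y|] on all of [[-1, 1]] as [N] grows, and have a mean that involves only finitely many values
    of the characteristic function. *)
Definition lacunary_sum (N : nat) y : R :=
  \sum_(k < N) 2 ^- k * (1 - cos (2 ^+ k * y)).

Lemma lacunary_sumS N y :
  lacunary_sum N.+1 y = (1 - cos y) + lacunary_sum N (2 * y) / 2.
Proof.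
rewrite /lacunary_sum big_ord_recl/= expr0 invr1 !mul1r mulr_suml; congr (_ + _).
apply: eq_bigr => i _; rewrite /bump/= add1n.
rewrite mulrA -exprSr exprSr invfM; ring.
Qed.

(* [F v := 8 v / (1 + v)] satisfies [F v - F (2 v) / 2 >= min 2 (v ^ 2 / 2)],
   which is what the recursion of [lacunary_sumS] requires. *)
Lemma lacunary_sum_le N y : lacunary_sum N y <= 8 * (`|y| / (1 + `|y|)).
Proof.
elim: N y => [|N IH] y.
  by rewrite /lacunary_sum big_ord0 mulr_ge0// divr_ge0// addr_ge0.
rewrite lacunary_sumS.
have := IH (2 * y); rewrite normrM (@ger0_norm _ 2)//.
set v := `|y|; have v0 : 0 <= v by rewrite normr_ge0.
have c1 : 1 - cos y <= v ^+ 2 / 2.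
  by rewrite /v real_normK ?num_real//; exact: onem_cos_le_sqr.
have c2 := onem_cos_le2 y.
set L := lacunary_sum N _ => hL.
suff h : 1 - cos y <= 8 * (v / (1 + v)) - 4 * (2 * v / (1 + 2 * v)) by lra.
have v1 : 1 + v != 0 by rewrite lt0r_neq0//; lra.
have v2 : 1 + 2 * v != 0 by rewrite lt0r_neq0//; lra.
have -> : 8 * (v / (1 + v)) - 4 * (2 * v / (1 + 2 * v)) =
          8 * v ^+ 2 / ((1 + v) * (1 + 2 * v)) by field; rewrite v1 v2.
rewrite ler_pdivlMr; last by nra.
have [v2'|v2'] := leP v 2.
  apply: (@le_trans _ _ (v ^+ 2 / 2 * ((1 + v) * (1 + 2 * v)))).
    by apply: ler_wpM2r => //; nra.
  have : (1 + v) * (1 + 2 * v) <= 16 by nra.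
  by have := sqr_ge0 v; nra.
apply: (@le_trans _ _ (2 * ((1 + v) * (1 + 2 * v)))).
  by apply: ler_wpM2r => //; nra.
by nra.
Qed.

Lemma lacunary_sum_ge0 N y : 0 <= lacunary_sum N y.
Proof.
by apply: sumr_ge0 => k _; rewrite mulr_ge0 ?onem_cos_ge0//.
Qed.

(** Induction by doubling [y]: as soon as [1/2 <= |y|], the first term is at least
    [y^2 / 8 >= |y| / 16], and each doubling of a smaller [y] uses one unit of [N]. *)
Lemma lacunary_sum_ge N y : 2 ^- N <= `|y| <= 1 ->
  `|y| / 16 <= lacunary_sum N.+1 y.
Proof.
elim: N y => [|N IH] y /andP[y0 y1]; rewrite lacunary_sumS.
  have -> : lacunary_sum 0 (2 * y) = 0 by rewrite /lacunary_sum big_ord0.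
  move: y0; rewrite expr0 invr1 => y0.
  have y2 : `|y| <= 2 by lra.
  have := onem_cos_ge_sqr _ y2; rewrite -[y ^+ 2]real_normK ?num_real//; nra.
have [yh|yh] := leP (1 / 2) `|y|.
  have h0 := lacunary_sum_ge0 N.+1 (2 * y).
  have : `|y| <= 2 by lra.
  move/onem_cos_ge_sqr; rewrite -[y ^+ 2]real_normK ?num_real//; nra.
have := IH (2 * y); rewrite normrM (@ger0_norm _ 2)//.
move: y0; rewrite exprS invfM => y0.
have -> : 2 ^- N <= 2 * `|y| <= 1 by lra.
move=> /(_ isT); have := onem_cos_ge0 y; lra.
Qed.

(** Both sides are compared with [v / (1 + v)] for [v = |y|], using [min(1, v) <= 2 v / (1 + v)]. *)
Lemma norm_sin_le_onemexpR y : y <= 0 -> `|sin y| <= 2 * (1 - expR y).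
Proof.
move=> y0; have h : 0 <= - y by lra.
have := onemexpRN_ge _ h; rewrite opprK.
have := norm_sin_le y; rewrite (ler0_norm y0).
have := sin_max y; set s := `|sin y| => s1 sy.
suff : s / 2 <= - y / (1 - y) by lra.
rewrite ler_pdivlMr; last lra.
have : 0 <= s by rewrite normr_ge0.
nra.
Qed.

(** For [y <= 0] the lacunary sum costs [8 (1 - e^y)] and the sine term at most [32 (1 - e^y)],
    whence [40]. For [0 < y <= 1], [8 y <= 16 sin y]. For [y > 1] the bound [8] is covered by
    [24 - 16]. *)
Lemma lacunary_sum_le_payoff N y : lacunary_sum N y <=
  40 * Num.max (1 - expR y) 0 + 16 * sin y + 24 * Num.min 1 (y ^+ 2).
Proof.
have hl := lacunary_sum_le N y.
have m0 : 0 <= Num.min 1 (y ^+ 2) by rewrite le_min ler01 sqr_ge0.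
have [y0|y0] := leP y 0.
  have p0 : 0 <= Num.max (1 - expR y) 0 by rewrite le_max lexx orbT.
  have p1 : 1 - expR y <= Num.max (1 - expR y) 0 by rewrite le_max lexx.
  have h : 0 <= - y by lra.
  have := onemexpRN_ge _ h; rewrite opprK => hy.
  move: hl; rewrite (ler0_norm y0).
  have := norm_sin_le_onemexpR _ y0; rewrite ler_norml => /andP[]; lra.
have p0 : 0 <= Num.max (1 - expR y) 0 by rewrite le_max lexx orbT.
move: hl; rewrite (gtr0_norm y0) => hl.
have [y1|y1] := leP y 1.
  have := half_le_sin y; rewrite y1 (ltW y0) => /(_ isT) hs.
  have : y / (1 + y) <= y by rewrite ler_pdivrMr; nra.
  lra.
have -> : Num.min 1 (y ^+ 2) = 1 by apply/min_idPl; nra.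
have : y / (1 + y) <= 1 by rewrite ler_pdivrMr; nra.
have := sin_geN1 y; lra.
Qed.

(** A bounded minorant of [e^y], exact to first order at [0]. For [y < 0] the error
    [sin y - y <= y^2 / 2] is absorbed when the minimum is [y^2], and the left side is nonpositive
    when the minimum is [1]. *)
Lemma sin_min_sqr_le_expR y : 1 + sin y - 2 * Num.min 1 (y ^+ 2) <= expR y.
Proof.
have := expR_ge1Dx y; have := expR_ge0 y.
have m0 : 0 <= Num.min 1 (y ^+ 2) by rewrite le_min ler01 sqr_ge0.
have [y0|y0] := leP 0 y; first by have := sin_le_id _ y0; lra.
have := norm_sin_sub_le y; rewrite ler_norml => /andP[_].
have := sin_le1 y.
rewrite /Num.min; case: ifP => _; have := sqr_ge0 y; lra.
Qed.

(** A Riemann sum of [1 - cos (u y)] over [u] in [[0, 1]]. Since it is a finite sum, its mean is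
    computed by linearity alone. *)
Definition mean_onem_cos (n : nat) y : R :=
  n%:R^-1 * \sum_(k < n) (1 - cos (k.+1%:R / n%:R * y)).

(** The Dirichlet kernel identity. *)
Lemma sum_cos_telescope n (w : R) :
  2 * sin (w / 2) * \sum_(k < n) cos (k.+1%:R * w) =
  sin (n%:R * w + w / 2) - sin (w / 2).
Proof.
elim: n => [|n IH]; first by rewrite big_ord0 mulr0 mul0r add0r subrr.
rewrite big_ord_recr/= mulrDr IH.
have -> : n%:R * w + w / 2 = n.+1%:R * w - w / 2 by rewrite -natr1; field.
by rewrite sinB sinD; ring.
Qed.

Lemma sum_sqr_ge n : n%:R ^+ 3 / 3 <= \sum_(k < n) (k.+1%:R : R) ^+ 2.
Proof.
elim: n => [|n IH]; first by rewrite big_ord0 expr0n/= mul0r.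
rewrite big_ord_recr/= -natr1.
have : (0 : R) <= n%:R by [].
move: IH; set s := \sum_(_ < _) _; set m := n%:R; rewrite !exprS expr0; nra.
Qed.

(** For [|y| <= 2] each term is at least an eighth of its squared angle, and the squares are summed.
    For larger [|y|] the cosines cancel by the Dirichlet kernel. *)
Lemma mean_onem_cos_ge n y : (0 < n)%N -> 4 * `|y| <= n%:R ->
  Num.min 1 (y ^+ 2) / 32 <= mean_onem_cos n y.
Proof.
move=> n0 yn.
have nR : 0 < (n%:R : R) by rewrite ltr0n.
have -> : mean_onem_cos n y = mean_onem_cos n `|y|.
  congr (_ * _); apply: eq_bigr => k _.
  by rewrite -[in LHS]cos_norm normrM (@ger0_norm _ (_ / _))// divr_ge0.
rewrite -[y ^+ 2]real_normK ?num_real//.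
set v := `|y| in yn *; have v0 : 0 <= v by exact: normr_ge0.
rewrite mulrC; rewrite /mean_onem_cos ler_pdivlMl//.
have [v2|v2] := leP v 2.
  apply: (@le_trans _ _ (\sum_(k < n) (k.+1%:R / n%:R * v) ^+ 2 / 8)); last first.
    apply: ler_sum => k _; apply: onem_cos_ge_sqr.
    have k1 : (k.+1%:R / n%:R : R) <= 1 by rewrite ler_pdivrMr// mul1r ler_nat.
    have k0 : 0 <= (k.+1%:R / n%:R : R) by rewrite divr_ge0.
    rewrite ger0_norm; nra.
  rewrite -mulr_suml.
  under eq_bigr do rewrite !exprMn.
  rewrite -mulr_suml -mulr_suml.
  have h := sum_sqr_ge n.
  have -> : (n%:R * (32^-1 * Num.min 1 (v ^+ 2)) : R) =
     (n%:R ^+ 3 / 3 * n%:R^-1 ^+ 2 * Num.min 1 (v ^+ 2)) * (3 / 32).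
    by field; rewrite lt0r_neq0.
  have hm : Num.min 1 (v ^+ 2) <= v ^+ 2 by rewrite ge_min lexx orbT.
  have hm0 : 0 <= Num.min 1 (v ^+ 2) by rewrite le_min ler01 sqr_ge0.
  have : n%:R ^+ 3 / 3 * n%:R^-1 ^+ 2 * Num.min 1 (v ^+ 2) <=
       (\sum_(k < n) k.+1%:R ^+ 2) * n%:R^-1 ^+ 2 * v ^+ 2.
    apply: ler_pM => //.
    by apply: ler_wpM2r => //; rewrite exprn_ge0// invr_ge0.
  have : 0 <= (\sum_(k < n) k.+1%:R ^+ 2) * n%:R^-1 ^+ 2 * v ^+ 2.
    by rewrite !mulr_ge0 ?sumr_ge0// ?exprn_ge0 ?invr_ge0// => k _; exact: sqr_ge0.
  lra.
have -> : Num.min 1 (v ^+ 2) = 1 by apply/min_idPl; nra.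
(* Doubling each angle twice costs a factor [16] and gives [w n = 4 v > 8], so that [S w <= 4]
   forces [S <= n / 2]. The hypothesis [4 |y| <= n] keeps [w <= 1], which yields
   [sin (w / 2) >= w / 4]. *)
pose w := 4 * v / n%:R.
have w0 : 0 < w by rewrite divr_gt0//; lra.
have w1 : w <= 1 by rewrite ler_pdivrMr// mul1r.
have wn : w * n%:R = 4 * v by rewrite divfK// lt0r_neq0.
apply: (@le_trans _ _ (\sum_(k < n) (1 - cos (k.+1%:R * w)) / 16)); last first.
  apply: ler_sum => k _; set u := k.+1%:R / n%:R * v.
  have -> : k.+1%:R * w = 2 * (2 * u) by rewrite /w /u; field; rewrite lt0r_neq0.
  have := onem_cos_double (2 * u); have := onem_cos_double u; lra.
rewrite -mulr_suml sumrB sumr_const card_ord.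
have := sum_cos_telescope n w; set S := \sum_(_ < _) cos _ => hS.
have := half_le_sin (w / 2); have -> : 0 <= w / 2 <= 1 by lra.
move=> /(_ isT) hs.
have : S * w <= 4.
  have [S0|S0] := leP S 0; first by nra.
  have : S * w <= 2 * (2 * sin (w / 2) * S) by nra.
  rewrite hS; have := sin_le1 (n%:R * w + w / 2).
  have := sin_geN1 (w / 2); lra.
move=> Sw; rewrite mulr1.
have : S <= n%:R / 2; last by lra.
rewrite -(ler_pM2r w0); lra.
Qed.

End test_functions.

(** * Bounded random variables *)

Section bounded_measurable.
Context {d : measure_display} {T : measurableType d} {R : realType}
  (P : probability T R).
Implicit Types f g : T -> R.

(** A class of integrable functions stable under all the operations used here, so that linearity and
    monotonicity of the mean need no separate integrability argument. *)
Definition bounded_measurable f :=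
  measurable_fun setT f /\ exists M : R, forall w, `|f w| <= M.

Lemma bounded_measurable_integrable f : bounded_measurable f ->
  P.-integrable setT (EFin \o f).
Proof.
move=> [mf [M fM]].
apply: (le_integrable measurableT) (finite_measure_integrable_cst P M measurableT).
  exact/measurable_EFinP.
by move=> w _ /=; rewrite lee_fin (le_trans (fM w))// ler_norm.
Qed.

Lemma bounded_measurable_cst (c : R) : bounded_measurable (fun=> c).
Proof. by split; [exact: measurable_cst|exists `|c|]. Qed.

Lemma bounded_measurableD f g : bounded_measurable f -> bounded_measurable g ->
  bounded_measurable (fun w => f w + g w).
Proof.
move=> [mf [M fM]] [mg [N gN]]; split; first exact: measurable_funD.
by exists (M + N) => w; rewrite (le_trans (ler_normD _ _))// lerD.
Qed.

Lemma bounded_measurableM f g : bounded_measurable f -> bounded_measurable g ->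
  bounded_measurable (fun w => f w * g w).
Proof.
move=> [mf [M fM]] [mg [N gN]]; split; first exact: measurable_funM.
by exists (M * N) => w; rewrite normrM ler_pM.
Qed.

Lemma bounded_measurableB f g : bounded_measurable f -> bounded_measurable g ->
  bounded_measurable (fun w => f w - g w).
Proof.
move=> [mf [M fM]] [mg [N gN]]; split; first exact: measurable_funB.
by exists (M + N) => w; rewrite (le_trans (ler_normB _ _))// lerD.
Qed.

Lemma bounded_measurable_sum (n : nat) (F : 'I_n -> T -> R) :
  (forall i, bounded_measurable (F i)) ->
  bounded_measurable (fun w => \sum_(i < n) F i w).
Proof.
move=> bF; split; first by apply: measurable_sum => i; case: (bF i).
have [M hM] := choice (fun i => (bF i).2).
by exists (\sum_(i < n) M i) => w; rewrite (le_trans (ler_norm_sum _ _ _))// ler_sum.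
Qed.

Lemma measurable_cos : measurable_fun setT (@cos R).
Proof. by apply: continuous_measurable_fun; exact: continuous_cos. Qed.

Lemma measurable_sin : measurable_fun setT (@sin R).
Proof. by apply: continuous_measurable_fun; exact: continuous_sin. Qed.

Lemma bounded_measurable_cos f : measurable_fun setT f ->
  bounded_measurable (fun w => cos (f w)).
Proof.
move=> mf; split; first exact: (measurableT_comp measurable_cos).
by exists 1 => w; exact: cos_max.
Qed.

Lemma bounded_measurable_sin f : measurable_fun setT f ->
  bounded_measurable (fun w => sin (f w)).
Proof.
move=> mf; split; first exact: (measurableT_comp measurable_sin).
by exists 1 => w; exact: sin_max.
Qed.

Lemma bounded_measurable_indic (A : set T) : measurable A ->
  bounded_measurable (\1_A : T -> R).
Proof.
move=> mA; split; first exact: measurable_indic.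
by exists 1 => w; rewrite indicE; case: (_ \in _); rewrite ?normr1 ?normr0.
Qed.

Lemma bounded_measurable_min_sqr f : measurable_fun setT f ->
  bounded_measurable (fun w => Num.min 1 (f w ^+ 2)).
Proof.
move=> mf; split.
  apply: (measurable_minr (measurable_cst _)).
  exact: (measurable_funX 2 mf).
exists 1 => w; rewrite ger0_norm; first by rewrite ge_min lexx.
by rewrite le_min ler01 sqr_ge0.
Qed.

Lemma mean_cst (c : R) : Rintegral P setT (fun=> c) = c.
Proof. by rewrite Rintegral_cst// [X in fine X](probability_setT P) mulr1. Qed.

Lemma meanD f g : bounded_measurable f -> bounded_measurable g ->
  Rintegral P setT (fun w => f w + g w) = Rintegral P setT f + Rintegral P setT g.
Proof. by move=> bf bg; rewrite RintegralD//; exact: bounded_measurable_integrable. Qed.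

Lemma meanB f g : bounded_measurable f -> bounded_measurable g ->
  Rintegral P setT (fun w => f w - g w) = Rintegral P setT f - Rintegral P setT g.
Proof. by move=> bf bg; rewrite RintegralB//; exact: bounded_measurable_integrable. Qed.

Lemma meanZ (c : R) f : bounded_measurable f ->
  Rintegral P setT (fun w => c * f w) = c * Rintegral P setT f.
Proof. by move=> bf; rewrite RintegralZl//; exact: bounded_measurable_integrable. Qed.

Lemma mean_sum (n : nat) (F : 'I_n -> T -> R) :
  (forall i, bounded_measurable (F i)) ->
  Rintegral P setT (fun w => \sum_(i < n) F i w) =
  \sum_(i < n) Rintegral P setT (F i).
Proof.
elim: n F => [|n IH] F bF.
  rewrite big_ord0 -[RHS](mean_cst 0); congr Rintegral.
  by apply/funext => w; rewrite big_ord0.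
rewrite big_ord_recr/= -IH// -meanD//; last by exact: bounded_measurable_sum.
by congr Rintegral; apply/funext => w; rewrite big_ord_recr.
Qed.

Lemma le_mean f g : bounded_measurable f -> bounded_measurable g ->
  (forall w, f w <= g w) -> Rintegral P setT f <= Rintegral P setT g.
Proof.
move=> bf bg fg; apply: le_Rintegral => //; exact: bounded_measurable_integrable.
Qed.

Lemma bounded_measurable_norm f : bounded_measurable f ->
  bounded_measurable (fun w => `|f w|).
Proof.
move=> [mf [M hM]]; split; first exact: measurableT_comp.
by exists M => w; rewrite normr_id.
Qed.

Lemma norm_mean_le f g : bounded_measurable f -> bounded_measurable g ->
  (forall w, `|f w| <= g w) -> `|Rintegral P setT f| <= Rintegral P setT g.
Proof.
move=> bf bg fg; apply: (@le_trans _ _ (Rintegral P setT (fun w => `|f w|))).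
  by apply: le_normr_Rintegral => //; exact: bounded_measurable_integrable.
by apply: le_mean => //; exact: bounded_measurable_norm.
Qed.

Lemma EFin_mean f : bounded_measurable f ->
  (Rintegral P setT f)%:E = (\int[P]_w (f w)%:E)%E.
Proof.
move=> bf; rewrite fineK//.
by apply: integrable_fin_num => //; exact: bounded_measurable_integrable.
Qed.

Lemma ae_eq_mean f g : bounded_measurable f -> bounded_measurable g ->
  {ae P, forall w, f w = g w} -> Rintegral P setT f = Rintegral P setT g.
Proof.
move=> [mf _] [mg _] fg; congr fine; apply: ae_eq_integral => //.
- exact/measurable_EFinP.
- exact/measurable_EFinP.
- by apply: filterS fg => w -> _.
Qed.

Lemma mean_cvg (F : nat -> T -> R) f (M : R) :
  (forall n, measurable_fun setT (F n)) -> measurable_fun setT f ->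
  (forall n w, `|F n w| <= M) ->
  {ae P, forall w, F n w @[n --> \oo] --> f w} ->
  Rintegral P setT (F n) @[n --> \oo] --> Rintegral P setT f.
Proof.
move=> mF mf FM cF.
have [|||||intf _] := @dominated_convergence _ _ _ P setT measurableT
  (fun n w => (F n w)%:E) (EFin \o f) (cst M%:E).
- by move=> n; exact/measurable_EFinP.
- exact/measurable_EFinP.
- by apply: filterS cF => w cw _; apply: cvg_EFin => //; exact: nearW.
- exact: (finite_measure_integrable_cst P M measurableT).
- by apply: aeW => w n _ /=; rewrite lee_fin.
move=> cv; apply: fine_cvg; rewrite fineK//.
exact: integrable_fin_num.
Qed.

Lemma cvgn_le (u : nat -> R) (l c : R) : u n @[n --> \oo] --> l ->
  (\forall n \near \oo, u n <= c) -> l <= c.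
Proof.
move=> ul uc; rewrite -(cvg_lim (@Rhausdorff R) ul).
by apply: limr_le => //; exact: cvgP ul.
Qed.

(** The hypothesis is averaged over a grid of [u] and combined with the pointwise bound on
    [mean_onem_cos]: the characteristic function near [0] controls a truncated second moment. *)
Lemma mean_min_sqr_le (Z : T -> R) (c : R) : measurable_fun setT Z ->
  (forall u, 0 <= u <= 1 -> Rintegral P setT (fun w => 1 - cos (u * Z w)) <= c) ->
  Rintegral P setT (fun w => Num.min 1 (Z w ^+ 2)) <= 32 * c.
Proof.
move=> mZ hc.
(* On [A n] the mesh [1 / n] is fine enough for the pointwise bound. These sets increase to the
   whole space, and dominated convergence removes the restriction. *)
pose A n : set T := [set w | 4 * `|Z w| <= n%:R].
have mA n : measurable (A n).
  rewrite -[A n]setTI; apply: measurable_fun_le => //.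
  by apply: measurable_funM => //; exact: measurableT_comp.
pose F n w : R := \1_(A n) w * Num.min 1 (Z w ^+ 2).
have bF n : bounded_measurable (F n).
  apply: bounded_measurableM; first exact: bounded_measurable_indic.
  exact: bounded_measurable_min_sqr.
have bcos u : bounded_measurable (fun w => 1 - cos (u * Z w)).
  apply: bounded_measurableB; first exact: bounded_measurable_cst.
  by apply: bounded_measurable_cos; exact: measurable_funM.
have m0 w : 0 <= Num.min 1 (Z w ^+ 2) by rewrite le_min ler01 sqr_ge0.
have hF n : (0 < n)%N -> Rintegral P setT (F n) <= 32 * c.
  move=> n0.
  have bs : bounded_measurable
      (fun w => \sum_(k < n) (1 - cos (k.+1%:R / n%:R * Z w))).
    by apply: bounded_measurable_sum => k.
  apply: (@le_trans _ _ (Rintegral P setT (fun w => 32 * (n%:R^-1 *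
      \sum_(k < n) (1 - cos (k.+1%:R / n%:R * Z w)))))).
    apply: le_mean => //.
      apply: bounded_measurableM; first exact: bounded_measurable_cst.
      by apply: bounded_measurableM => //; exact: bounded_measurable_cst.
    move=> w; rewrite /F indicE; case: (boolP (w \in A n)) => [|_] /=.
      rewrite inE => Aw; rewrite mul1r.
      have := mean_onem_cos_ge n (Z w) n0 Aw.
      by rewrite /mean_onem_cos; lra.
    rewrite mul0r !mulr_ge0 ?sumr_ge0// => k _; exact: onem_cos_ge0.
  rewrite meanZ; last by apply: bounded_measurableM => //; exact: bounded_measurable_cst.
  rewrite ler_pM2l// meanZ// mean_sum//.
  have nR : 0 < (n%:R : R) by rewrite ltr0n.
  rewrite ler_pdivrMl// mulrC mulr_natr.
  rewrite -[in leRHS](card_ord n) -sumr_const; apply: ler_sum => k _.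
  by apply: hc; rewrite divr_ge0//= ler_pdivrMr// mul1r ler_nat.
apply: (@cvgn_le (fun n => Rintegral P setT (F n))).
  apply: (mean_cvg F _ 1) => //.
  - by move=> n; case: (bF n).
  - by case: (bounded_measurable_min_sqr _ mZ).
  - move=> n w; rewrite ger0_norm /F; last by rewrite mulr_ge0.
    rewrite indicE; case: (_ \in _); rewrite ?mul1r ?mul0r//.
    by rewrite ge_min lexx.
  - apply: aeW => w; apply: cvg_near_cst.
    near=> n; rewrite /F indicE mem_set ?mul1r// /A /=.
    near: n; exact: nbhs_infty_ger.
near=> n; apply: hF; near: n; exact: nbhs_infty_gt.
Unshelve. all: by end_near. Qed.

(** The hypothesis says that the joint law of [f] and [g] is the product of their laws; Tonelli then
    factors the integral. *)
Lemma mean_mul_indep_ge0 f g : bounded_measurable f -> bounded_measurable g ->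
  (forall w, 0 <= f w) -> (forall w, 0 <= g w) ->
  (forall B C : set R, measurable B -> measurable C ->
    P (f @^-1` B `&` g @^-1` C) = P (f @^-1` B) * P (g @^-1` C))%E ->
  Rintegral P setT (fun w => f w * g w) = Rintegral P setT f * Rintegral P setT g.
Proof.
move=> bf bg f0 g0 ifg.
have [mf _] := bf; have [mg _] := bg.
pose f' : {RV P >-> R} := mfun_Sub (mem_set mf).
pose g' : {RV P >-> R} := mfun_Sub (mem_set mg).
have mfg : measurable_fun setT (fun w => (f w, g w)) by exact: measurable_fun_pair.
pose fg' : {RV P >-> (R * R)%type} := mfun_Sub (mem_set mfg).
(* Absolute values make the integrand nonnegative on the whole plane, as Tonelli requires, and
   change nothing on the values of [f] and [g]. *)
pose h (z : R * R) : \bar R := (`|z.1| * `|z.2|)%:E.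
have mh : measurable_fun setT h.
  apply/measurable_EFinP; apply: measurable_funM.
    by apply: measurableT_comp => //; exact: measurable_fst.
  by apply: measurableT_comp => //; exact: measurable_snd.
apply: EFin_inj; rewrite EFinM !EFin_mean//; last exact: bounded_measurableM.
transitivity (\int[distribution P fg']_z h z)%E.
  rewrite ge0_integral_distribution//; last by move=> z; rewrite lee_fin mulr_ge0.
  by apply: eq_integral => w _; rewrite /h /= !ger0_norm.
rewrite -(@eq_measure_integral _ _ _ setT (distribution P fg')
   (distribution P f' \x distribution P g')%E); last first.
  by move=> A mA _; apply: product_measure_unique.
rewrite fubini_tonelli1//; last by move=> z; rewrite lee_fin mulr_ge0.
rewrite /fubini_F /h /=.
have mabs : measurable_fun setT (fun x : R => `|x|%:E).
  by apply/measurable_EFinP; apply: normr_measurable.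
under eq_integral => x _.
  under eq_integral do rewrite EFinM.
  rewrite ge0_integralZl//; [over|first [exact: mabs|by rewrite lee_fin]..].
rewrite ge0_integralZr//; [|first [exact: mabs|exact: integral_ge0]..].
rewrite !ge0_integral_distribution//.
by congr (_ * _)%E; apply: eq_integral => w _ /=; rewrite ger0_norm.
Qed.

(** Adding their bounds makes [f] and [g] nonnegative; after expansion the extra terms cancel by
    linearity. *)
Lemma mean_mul_indep f g : bounded_measurable f -> bounded_measurable g ->
  (forall B C : set R, measurable B -> measurable C ->
    P (f @^-1` B `&` g @^-1` C) = P (f @^-1` B) * P (g @^-1` C))%E ->
  Rintegral P setT (fun w => f w * g w) = Rintegral P setT f * Rintegral P setT g.
Proof.
move=> bf bg ifg; have [_ [M fM]] := bf; have [_ [N gN]] := bg.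
have bc (c : R) : bounded_measurable (fun _ : T => c) by exact: bounded_measurable_cst.
have := @mean_mul_indep_ge0 (fun w => M + f w) (fun w => N + g w).
have sh (c : R) (B : set R) : measurable B -> measurable ((fun x => c + x) @^-1` B).
  by move=> mB; rewrite -[_ @^-1` _]setTI; exact: measurable_funD.
move=> /(_ (bounded_measurableD _ _ (bc M) bf) (bounded_measurableD _ _ (bc N) bg)).
have M0 w : 0 <= M + f w by have := fM w; rewrite ler_norml; lra.
have N0 w : 0 <= N + g w by have := gN w; rewrite ler_norml; lra.
move=> /(_ M0 N0).
have ii (B C : set R) : measurable B -> measurable C ->
    P ((fun w => M + f w) @^-1` B `&` (fun w => N + g w) @^-1` C) =
    (P ((fun w => M + f w)%R @^-1` B) * P ((fun w => N + g w)%R @^-1` C))%E.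
  by move=> mB mC; apply: (ifg _ _ (sh M _ mB) (sh N _ mC)).
move=> /(_ ii); rewrite !meanD// !mean_cst.
have -> : (fun w => (M + f w) * (N + g w)) =
    (fun w => (M * N + (N * f w + M * g w)) + f w * g w).
  by apply/funext => w; ring.
have bm1 : bounded_measurable (fun w => N * f w) by exact: bounded_measurableM.
have bm2 : bounded_measurable (fun w => M * g w) by exact: bounded_measurableM.
have bm3 : bounded_measurable (fun w => N * f w + M * g w).
  exact: bounded_measurableD.
rewrite !meanD// ?mean_cst ?meanZ//; last 2 first.
- exact: bounded_measurableD.
- exact: bounded_measurableM.
move=> h; nra.
Qed.

End bounded_measurable.

(** * Independence of increments from the past *)

Section independence.
Context {d : measure_display} {T : measurableType d} {R : realType}
  (P : probability T R).

(** As functions of [A] both sides are finite measures; they agree on the pi-system [G] and on the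
    whole space, hence on the sigma-algebra that [G] generates. *)
Lemma indep_generated (G : set (set T)) (D : set T) :
  G `<=` measurable -> setI_closed G -> measurable D ->
  (forall A, G A -> P (A `&` D) = P A * P D)%E ->
  forall A, <<s G >> A -> (P (A `&` D) = P A * P D)%E.
Proof.
move=> mG GI mD GD A sA.
have PD : P D = (fine (P D))%:E by rewrite fineK// fin_num_measure.
have pD : 0 <= fine (P D) by rewrite fine_ge0.
have -> : (P A * P D = mscale (NngNum pD) P A)%E.
  by rewrite /mscale /= [LHS]muleC -PD.
pose H := [set X | G X /\ X `<=` setT].
have HG : H = G by apply/seteqP; split => [B []//|B GB]; split.
have h := @g_sigma_algebra_measure_unique_trace _ R T G setT measurableT.
have := h _ _ (mrestr P mD) (mscale (NngNum pD) P); apply => //; rewrite -/H ?HG//.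
- transitivity (P (setT `&` D)) => //; rewrite setTI.
  transitivity ((fine (P D))%:E * P setT)%E => //.
  by rewrite probability_setT mule1 -PD.
- move=> B GB; transitivity (P (B `&` D)) => //.
  transitivity ((fine (P D))%:E * P B)%E => //.
  by rewrite GD// muleC -PD.
- apply: (@le_lt_trans _ _ (P (setT `&` D))) => //.
  by rewrite setTI (le_lt_trans (probability_le1 P mD)) ?ltry.
Qed.

End independence.

(** * Increments of a Lévy process and its natural filtration *)

Section levy_independence.
Context {R : realType} {d : measure_display} {Omega : measurableType d}
  (P : probability Omega R) (X : R -> Omega -> R).
Hypothesis mX : forall t, measurable_fun setT (X t).
Hypothesis X0 : {ae P, forall w, X 0 w = 0}.
Hypothesis iX : independent_increments P X.

Let minc s t : measurable_fun setT (increment X s t).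
Proof. exact: measurable_funB. Qed.

Let mpre (f : Omega -> R) (B : set R) :
  measurable_fun setT f -> measurable B -> measurable (f @^-1` B).
Proof. by move=> mf mB; rewrite -[_ @^-1` _]setTI; exact: mf. Qed.

Lemma measure_start (E : set Omega) (B : set R) : measurable E -> measurable B ->
  P (X 0 @^-1` B `&` E) = if 0 \in B then P E else 0%E.
Proof.
move=> mE mB; have mXB : measurable (X 0 @^-1` B) by exact: mpre.
case: ifPn => [|]; rewrite ?notin_setE ?inE => B0.
  rewrite -[X in P X = _]setIT -[E in RHS]setTI -[in RHS](setUv (X 0 @^-1` B)).
  have [N [mN PN XN]] := X0.
  rewrite setIT setIUl measureU; last 3 first.
  - exact: measurableI.
  - by apply: measurableI => //; exact: measurableC.
  - by rewrite setIACA setICr set0I.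
  rewrite (@subset_measure0 _ _ _ P (~` (X 0 @^-1` B) `&` E) N) ?adde0//.
  - by apply: measurableI => //; exact: measurableC.
  - by move=> w [nB _]; apply: XN => /= w0; apply: nB; rewrite /preimage /= w0.
have [N [mN PN XN]] := X0.
apply: (@subset_measure0 _ _ _ P _ N) => //; first exact: measurableI.
by move=> w [wB _]; apply: XN => /= w0; apply: B0; rewrite -w0.
Qed.

(** The pi-system consists of joint events on [X 0] and the successive increments. Each [X (t j)] is
    measurable for the sigma-algebra it generates, being [X 0] plus increments. *)
Lemma grid_indep (n : nat) (t : nat -> R) (B : set R) (A : set Omega) :
  t 0%N = 0 -> (forall i, (i < n.+1)%N -> t i < t i.+1) -> measurable B ->
  <<s [set A | exists j C, [/\ (j <= n)%N, measurable C & A = X (t j) @^-1` C]] >> A ->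
  P (A `&` increment X (t n) (t n.+1) @^-1` B) =
  (P A * P (increment X (t n) (t n.+1) @^-1` B))%E.
Proof.
move=> t0 tlt mB sA.
pose E (C : nat -> set R) : set Omega :=
  \bigcap_(i in `I_n) (increment X (t i) (t i.+1) @^-1` C i).
pose G : set (set Omega) := [set A | exists C0 C,
  [/\ measurable C0, (forall i, measurable (C i)) & A = X 0 @^-1` C0 `&` E C]].
have mE C : (forall i, measurable (C i)) -> measurable (E C).
  by move=> mC; apply: bigcap_measurableType => // i _; exact: mpre.
have GD A' : G A' -> P (A' `&` increment X (t n) (t n.+1) @^-1` B) =
    (P A' * P (increment X (t n) (t n.+1) @^-1` B))%E.
  move=> [C0 [C [mC0 mC ->]]].
  rewrite -setIA !measure_start//; last 2 first.
  - exact: mE.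
  - by apply: measurableI; [exact: mE|exact: mpre].
  case: ifP => _; last by rewrite mul0e.
  (* [B] becomes the constraint on increment [n]. Comparing independence of [n + 1] increments with
     that of the first [n] isolates the last factor. *)
  pose C' i := if i == n then B else C i.
  have mC' i : measurable (C' i) by rewrite /C'; case: ifP.
  have := iX n.+1 t C'; rewrite t0 lexx => /(_ isT tlt mC').
  have := iX n t C; rewrite t0 lexx => /(_ isT _ mC).
  have tlt' i : (i < n)%N -> t i < t i.+1 by move=> ?; apply: tlt; rewrite ltnS ltnW.
  move=> /(_ tlt') -> eC'.
  have C'n : C' n = B by rewrite /C' eqxx.
  rewrite big_ord_recr/= C'n in eC'.
  rewrite (eq_bigr (fun i : 'I_n => P (increment X (t i) (t i.+1) @^-1` C i)))
    in eC'; last by move=> i _; rewrite /C' ltn_eqF.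
  rewrite -eC'; congr (P _); apply/seteqP; split => w.
    move=> [wE wB] i /=; rewrite ltnS leq_eqVlt /C' => /predU1P[->|ilt].
      by rewrite eqxx.
    by rewrite ltn_eqF//; exact: wE.
  move=> h; split; last by have := h n (ltnSn n); rewrite /C' eqxx.
  by move=> i /= ilt; have := h i (ltnW ilt : (i < n.+1)%N); rewrite /C' ltn_eqF.
have GI : setI_closed G.
  move=> _ _ [C0 [C [mC0 mC ->]]] [D0 [D [mD0 mD ->]]].
  exists (C0 `&` D0), (fun i => C i `&` D i); split.
  - exact: measurableI.
  - by move=> i; exact: measurableI.
  - by rewrite /E setIACA -bigcapI; congr (_ `&` _).
have mG : G `<=` measurable.
  move=> _ [C0 [C [mC0 mC ->]]]; apply: measurableI; [exact: mpre|exact: mE].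
apply: (indep_generated P G _ mG GI (mpre _ _ (minc _ _) mB) GD).
move: A sA; apply: smallest_sub; first exact: smallest_sigma_algebra.
move=> _ [j [C [jn mC ->]]].
suff mj : measurable_fun setT (X (t j) : g_sigma_algebraType G -> R).
  by have := mj measurableT C mC; rewrite setTI.
elim: j jn => [_|j IH jn].
  move=> _ Y mY; rewrite setTI t0; apply: sub_gen_smallest.
  exists Y, (fun=> setT); split => //.
  by apply/seteqP; split => [w wY|w []//]; split => //.
have -> : X (t j.+1) = X (t j) \+ increment X (t j) (t j.+1).
  by apply/funext => w; rewrite /increment /= addrC subrK.
apply: measurable_funD; first by apply: IH; exact: ltnW.
move=> _ Y mY; rewrite setTI; apply: sub_gen_smallest.
exists setT, (fun i => if i == j then Y else setT); split => //.
  by move=> i; case: ifP.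
apply/seteqP; split => [w wY|w [_ /(_ j jn)]]; last by rewrite eqxx.
by split => // i _; case: ifPn => // /eqP ->.
Qed.

(** The sigma-algebras of finite sets of times in [[0, s]] form a directed family, so their union is
    a pi-system generating the natural filtration; each one is treated on a grid. *)
Lemma increment_indep (s s' : R) (A : set Omega) (B : set R) :
  0 <= s -> s < s' -> natural_filtration X s A -> measurable B ->
  P (A `&` increment X s s' @^-1` B) = (P A * P (increment X s s' @^-1` B))%E.
Proof.
move=> s0 ss' FA mB.
pose gen (l : seq R) := [set A | exists u (C : set R),
  [/\ u \in l, measurable C & A = X u @^-1` C]].
pose G : set (set Omega) := [set A | exists l : seq R,
  (forall u, u \in l -> 0 <= u <= s) /\ <<s gen l >> A].
have mgen l : <<s gen l >> `<=` measurable.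
  apply: smallest_sub; first exact: sigma_algebra_measurable.
  by move=> _ [u [C [_ mC ->]]]; exact: mpre.
have GI : setI_closed G.
  move=> A1 A2 [l1 [l1s sA1]] [l2 [l2s sA2]]; exists (l1 ++ l2); split.
    by move=> u; rewrite mem_cat => /orP[/l1s|/l2s].
  have sub l : {subset l <= l1 ++ l2} -> <<s gen l >> `<=` <<s gen (l1 ++ l2) >>.
    move=> ll; apply: sub_smallest2r; first exact: smallest_sigma_algebra.
    by move=> _ [u [C [/ll ? ? ->]]]; exists u, C.
  have sA1' : (gen (l1 ++ l2)).-sigma.-measurable A1.
    by apply: sub sA1 => u; rewrite mem_cat => ->.
  have sA2' : (gen (l1 ++ l2)).-sigma.-measurable A2.
    by apply: sub sA2 => u; rewrite mem_cat => ->; rewrite orbT.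
  exact: measurableI sA1' sA2'.
have mG : G `<=` measurable by move=> A' [l [_ /mgen]].
apply: (indep_generated P G) => //; first exact: mpre; last first.
  move: A FA; apply: smallest_sub; first exact: smallest_sigma_algebra.
  move=> _ [u [C [us mC ->]]]; apply: sub_gen_smallest; exists [:: u]; split.
    by move=> v; rewrite inE => /eqP ->.
  by apply: sub_gen_smallest; exists u, C; split => //; rewrite inE.
move=> {FA} {}A [l [ls sA]].
(* The grid has to start at [0] and to contain [s], its largest element. *)
pose L := sort <=%R (undup (0 :: s :: l)).
have memL u : (u \in L) = (u \in 0 :: s :: l) by rewrite mem_sort mem_undup.
have Ls u : u \in L -> 0 <= u <= s.
  by rewrite memL !inE => /or3P[/eqP ->|/eqP ->|/ls//]; rewrite lexx ?s0.
have sL : sorted <%R L by rewrite sort_lt_sorted undup_uniq.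
have szL : (0 < size L)%N.
  have : 0 \in L by rewrite memL !inE eqxx.
  by case: (L).
pose n := (size L).-1; have nL : n.+1 = size L by rewrite /n prednK.
have sleL : sorted <=%R L by move: sL; rewrite lt_sorted_uniq_le => /andP[].
have nthle i j : (i <= j)%N -> (j < size L)%N -> nth 0 L i <= nth 0 L j.
  move=> ij jL; apply: (sorted_leq_nth le_trans le_refl) => //.
  by rewrite inE (leq_ltn_trans ij).
(* The default value [s'] past the end of the list is the grid point following [s], so the last
   increment is the one from [s] to [s']. *)
pose t i := if (i < size L)%N then nth 0 L i else s'.
have tn : t n = s.
  rewrite /t -nL ltnSn; have sL' : s \in L by rewrite memL !inE eqxx orbT.
  apply/le_anti/andP; split.
    by have /Ls/andP[] : nth 0 L n \in L by apply: mem_nth; rewrite -nL.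
  rewrite -{1}(nth_index 0 sL'); apply: nthle; last by rewrite -nL.
  by rewrite -ltnS nL index_mem.
have tn1 : t n.+1 = s' by rewrite /t -nL ltnn.
have t0 : t 0%N = 0.
  rewrite /t szL; have L0 : 0 \in L by rewrite memL !inE eqxx.
  apply/le_anti/andP; split; last first.
    by have /Ls/andP[] : nth 0 L 0 \in L by apply: mem_nth.
  by rewrite -{2}(nth_index 0 L0); apply: nthle => //; rewrite index_mem.
have tlt i : (i < n.+1)%N -> t i < t i.+1.
  rewrite ltnS leq_eqVlt => /predU1P[->|ilt]; first by rewrite tn tn1.
  rewrite /t -nL !ltnS ilt (ltnW ilt).
  by apply: (sorted_ltn_nth lt_trans) => //; rewrite inE -nL ltnS// ltnW.
have := grid_indep n t B A t0 tlt mB; rewrite tn tn1; apply.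
apply: sub_smallest2r sA; first exact: smallest_sigma_algebra.
move=> _ [u [C [ul mC ->]]]; have uL : u \in L by rewrite memL !inE ul !orbT.
exists (index u L), C; split => //; first by rewrite -ltnS nL index_mem.
by rewrite /t index_mem uL nth_index.
Qed.

End levy_independence.

(** * Stopped processes *)

Section rounding.
Context {R : realType}.
Implicit Types (h x : R) (G : R -> R).

(** For [h > 0] and [x >= 0], the least multiple of [h] strictly above [x]. Strictness makes the
    samples approach [x] from the right, where the paths are continuous. *)
Definition roundup h x : R := (Num.truncn (x / h)).+1%:R * h.

Lemma roundup_itv h x : 0 < h -> 0 <= x -> x < roundup h x <= x + h.
Proof.
move=> h0 x0; have /truncn_itv/andP[h1 h2] : 0 <= x / h by rewrite divr_ge0// ltW.
rewrite /roundup -ltr_pdivrMr// h2 /= -natr1 mulrDl mul1r lerD2r.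
by rewrite -ler_pdivlMr.
Qed.

Lemma telescope_indic (G : nat -> R) (j N : nat) : (j <= N)%N ->
  \sum_(k < N.+1) (k <= j)%N%:R * (G k.+1 - G k) = G j.+1 - G 0%N.
Proof.
move=> jN; suff h M : \sum_(k < M) (k <= j)%N%:R * (G k.+1 - G k) =
    G (minn M j.+1) - G 0%N by rewrite h (minn_idPr _).
elim: M => [|M IH]; first by rewrite big_ord0 min0n subrr.
rewrite big_ord_recr/= IH; have [Mj|jM] := leqP M j.
  rewrite mul1r (minn_idPl _) ?(leq_trans Mj)// (minn_idPl _)//; ring.
rewrite mul0r addr0 (minn_idPr _)// (minn_idPr _)//; exact: leq_trans jM _.
Qed.

(** A telescoping sum in which the increment starting at [k h] is switched on by [k h <= x]. For a
    stopping time, this condition is decided up to a null set when the increment starts. *)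
Lemma sampleE G h x (N : nat) : 0 < h -> 0 <= x -> x <= N%:R * h ->
  G (roundup h x) = G 0 +
    \sum_(k < N.+1) (k%:R * h <= x)%R%:R * (G (k.+1%:R * h) - G (k%:R * h)).
Proof.
move=> h0 x0 xN; have xh0 : 0 <= x / h by rewrite divr_ge0// ltW.
have jN : (Num.truncn (x / h) <= N)%N.
  rewrite -(ler_nat R); apply: le_trans (_ : x / h <= _); first by rewrite truncn_le.
  by rewrite ler_pdivrMr.
have := telescope_indic (fun k => G (k%:R * h)) _ _ jN; rewrite mul0r => e.
rewrite [LHS](_ : _ = G 0 + (G (roundup h x) - G 0)); last by rewrite addrC subrK.
rewrite /roundup -e; congr (_ + _); apply: eq_bigr => k _.
by rewrite truncn_ge_nat// ler_pdivlMr.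
Qed.

Lemma roundupE h x (N : nat) : 0 < h -> 0 <= x -> x <= N%:R * h ->
  roundup h x = \sum_(k < N.+1) (k%:R * h <= x)%R%:R * h.
Proof.
move=> h0 x0 xN; rewrite [LHS](sampleE id _ _ _ h0 x0 xN) add0r.
by apply: eq_bigr => k _; rewrite -natr1; congr (_ * _); ring.
Qed.

End rounding.

Section stopped_process.
Context {R : realType} {d : measure_display} {Omega : measurableType d}
  (P : probability Omega R) (X : R -> Omega -> R).
Hypothesis complP : complete_probability P.
Hypothesis levyX : levy_process P X.
Local Notation E f := (Rintegral P setT f).

Let mX t : measurable_fun setT (X t).
Proof. by case: levyX. Qed.

Let X0 : {ae P, forall w, X 0 w = 0}.
Proof. by case: levyX. Qed.

Let iX : independent_increments P X.
Proof. by case: levyX. Qed.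

Let sX : stationary_increments P X.
Proof. by case: levyX. Qed.

Lemma mean_stationary (g : R -> R) (s h : R) : 0 <= s -> 0 <= h ->
  measurable_fun setT g -> (exists M : R, forall x, `|g x| <= M) ->
  E (fun w => g (increment X s (s + h) w)) = E (fun w => g (X h w)).
Proof.
move=> s0 h0 mg [M gM].
have minc : measurable_fun setT (increment X s (s + h)) by exact: measurable_funB.
pose Y : {RV P >-> R} := mfun_Sub (mem_set minc).
pose Z : {RV P >-> R} := mfun_Sub (mem_set (mX h)).
have bY : bounded_measurable (fun w => g (Y w)).
  by split; [exact: measurableT_comp|exists M].
have bZ : bounded_measurable (fun w => g (Z w)).
  by split; [exact: measurableT_comp|exists M].
congr fine; have mEg : measurable_fun setT (EFin \o g) by exact/measurable_EFinP.
have := integral_distribution (X:=Y) mEg (bounded_measurable_integrable P _ bY).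
have := integral_distribution (X:=Z) mEg (bounded_measurable_integrable P _ bZ).
move=> <- <-; apply: eq_measure_integral => A mA _.
exact: sX.
Qed.

Lemma natural_filtration_measurable s A : natural_filtration X s A -> measurable A.
Proof.
move: A; apply: smallest_sub; first exact: sigma_algebra_measurable.
by move=> _ [u [B [_ mB ->]]]; rewrite -[_ @^-1` _]setTI; exact: mX.
Qed.

(** The addition formula writes the cosine at [s + h] with products of a factor known at [s] and the
    cosine or sine of the increment. Independence factors the means, and stationarity replaces the
    increment by [X h]. *)
Lemma mean_cos_increment_le (s h u a : R) (A : set Omega) :
  0 <= s -> 0 < h -> natural_filtration X s A ->
  `|E (fun w => \1_A w * (cos (u * X (s + h) w + a) - cos (u * X s w + a)))| <=
  E (\1_A : Omega -> R) *
    (`|E (fun w => cos (u * X h w)) - 1| + `|E (fun w => sin (u * X h w))|).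
Proof.
move=> s0 h0 FA; have mA := natural_filtration_measurable _ _ FA.
have muX t b : measurable_fun setT (fun w => u * X t w + b).
  by apply: measurable_funD => //; exact: measurable_funM.
have muD : measurable_fun setT (fun w => u * increment X s (s + h) w).
  by apply: measurable_funM => //; exact: measurable_funB.
pose Z1 w := cos (u * increment X s (s + h) w).
pose Z2 w := sin (u * increment X s (s + h) w).
have bZ1 : bounded_measurable Z1 by exact: bounded_measurable_cos.
have bZ2 : bounded_measurable Z2 by exact: bounded_measurable_sin.
have bA : bounded_measurable (\1_A : Omega -> R) by exact: bounded_measurable_indic.
have mu (g : R -> R) : measurable_fun setT g ->
    measurable_fun setT (fun x => g (u * x)).
  by move=> mg; apply: measurableT_comp => //; exact: measurable_funM.
have EZ1 : E Z1 = E (fun w => cos (u * X h w)).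
  apply: (mean_stationary (fun x => cos (u * x))) => //; first exact: ltW.
    by apply: mu; exact: measurable_cos.
  by exists 1 => x; exact: cos_max.
have EZ2 : E Z2 = E (fun w => sin (u * X h w)).
  apply: (mean_stationary (fun x => sin (u * x))) => //; first exact: ltW.
    by apply: mu; exact: measurable_sin.
  by exists 1 => x; exact: sin_max.
have bg (g : R -> R) : measurable_fun setT g -> (forall x, `|g x| <= 1) ->
    bounded_measurable (fun w => \1_A w * g (u * X s w + a)).
  move=> mg g1; apply: bounded_measurableM => //; split; first exact: measurableT_comp.
  by exists 1.
(* The first factor is measurable for the natural filtration at [s], so its preimages are
   independent of the increment. *)
have ind (g : R -> R) (Z : Omega -> R) (k : R -> R) : measurable_fun setT g ->
    (forall x, `|g x| <= 1) -> bounded_measurable Z ->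
    measurable_fun setT k -> Z = (fun w => k (increment X s (s + h) w)) ->
    E (fun w => (\1_A w * g (u * X s w + a)) * Z w) =
    E (fun w => \1_A w * g (u * X s w + a)) * E Z.
  move=> mg g1 bZ mk ZE; apply: mean_mul_indep => //; first exact: bg.
  move=> B C mB mC; rewrite ZE.
  have := increment_indep P X mX X0 iX s (s + h)
    ((fun w => \1_A w * g (u * X s w + a)) @^-1` B) (k @^-1` C) s0.
  apply => //; first by rewrite ltrDl.
    pose G := [set A | exists s' (B : set R),
      [/\ 0 <= s' <= s, measurable B & A = X s' @^-1` B]].
    have mXs : measurable_fun setT (X s : g_sigma_algebraType G -> R).
      move=> _ Y mY; rewrite setTI; apply: sub_gen_smallest; exists s, Y.
      by rewrite s0 lexx.
    suff mY : measurable_fun setT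
        ((fun w => \1_A w * g (u * X s w + a)) : g_sigma_algebraType G -> R).
      by have := mY measurableT B mB; rewrite setTI.
    apply: measurable_funM; first exact: measurable_indic.
    apply: measurableT_comp => //; apply: measurable_funD => //.
    exact: measurable_funM.
  by rewrite -[_ @^-1` _]setTI; exact: mk.
pose Y1 w := \1_A w * cos (u * X s w + a).
pose Y2 w := \1_A w * sin (u * X s w + a).
have bY1 : bounded_measurable Y1 by apply: bg; [exact: measurable_cos|exact: cos_max].
have bY2 : bounded_measurable Y2 by apply: bg; [exact: measurable_sin|exact: sin_max].
have e1 : E (fun w => Y1 w * Z1 w) = E Y1 * E Z1.
  apply: (ind _ _ (fun x => cos (u * x))) => //; first exact: measurable_cos.
  - exact: cos_max.
  - by apply: mu; exact: measurable_cos.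
have e2 : E (fun w => Y2 w * Z2 w) = E Y2 * E Z2.
  apply: (ind _ _ (fun x => sin (u * x))) => //; first exact: measurable_sin.
  - exact: sin_max.
  - by apply: mu; exact: measurable_sin.
have -> : (fun w => \1_A w * (cos (u * X (s + h) w + a) - cos (u * X s w + a))) =
    (fun w => (Y1 w * Z1 w - Y2 w * Z2 w) - Y1 w).
  apply/funext => w; rewrite /Y1 /Z1 /Y2 /Z2.
  have -> : u * X (s + h) w + a = (u * X s w + a) + u * increment X s (s + h) w.
    by rewrite /increment; ring.
  by rewrite cosD; ring.
have b1 : bounded_measurable (fun w => Y1 w * Z1 w) by exact: bounded_measurableM.
have b2 : bounded_measurable (fun w => Y2 w * Z2 w) by exact: bounded_measurableM.
rewrite !meanB//; last exact: bounded_measurableB.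
rewrite e1 e2 EZ1 EZ2.
have yle (Y : Omega -> R) (g : Omega -> R) : bounded_measurable Y ->
    Y = (fun w => \1_A w * g w) -> (forall w, `|g w| <= 1) ->
    `|E Y| <= E (\1_A : Omega -> R).
  move=> bY YE g1; apply: norm_mean_le => // w; rewrite YE normrM.
  rewrite indicE; case: (_ \in _); rewrite ?normr1 ?normr0 ?mul0r// mul1r.
  exact: g1.
have y1 : `|E Y1| <= E (\1_A : Omega -> R).
  by apply: yle => // w; exact: cos_max.
have y2 : `|E Y2| <= E (\1_A : Omega -> R).
  by apply: yle => // w; exact: sin_max.
set c := E (fun w => cos (u * X h w)); set c' := E (fun w => sin (u * X h w)).
have -> : E Y1 * c - E Y2 * c' - E Y1 = E Y1 * (c - 1) - E Y2 * c' by ring.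
rewrite [leRHS]mulrDr (le_trans (ler_normB _ _))// !normrM.
by apply: lerD; apply: ler_wpM2r.
Qed.

(** [A] and [B] coincide outside [N], and completeness handles the part of [A] inside [N]. *)
Lemma complete_measurable (A B N : set Omega) : measurable B -> null_event P N ->
  (A `\` B) `|` (B `\` A) `<=` N -> measurable A.
Proof.
move=> mB [mN PN] ABN.
have -> : A = (B `\` N) `|` (A `&` N).
  apply/seteqP; split => w.
    move=> Aw; have [Nw|Nw] := pselect (N w); [by right|left; split => //].
    by apply: contrapT => Bw; apply: Nw; apply: ABN; left.
  move=> [[Bw Nw]|[]//]; apply: contrapT => Aw; apply: Nw.
  by apply: ABN; right.
apply: measurableU; first exact: measurableD.
by apply: (complP N) => // w [].
Qed.

Lemma ae_cvg_measurable (F : nat -> Omega -> R) (f : Omega -> R) :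
  (forall n, measurable_fun setT (F n)) ->
  {ae P, forall w, F n w @[n --> \oo] --> f w} -> measurable_fun setT f.
Proof.
move=> mF [N [mN PN hN]].
have mC : measurable (~` N) by exact: measurableC.
have m1 : measurable_fun setT (\1_(~` N) : Omega -> R) by exact: measurable_indic.
have mg : measurable_fun setT (fun w => \1_(~` N) w * f w).
  apply: (@measurable_fun_cvg _ _ _ setT (fun n w => \1_(~` N) w * F n w)).
    by move=> n; exact: measurable_funM.
  move=> w _; have [Nw|Nw] := pselect (N w).
    rewrite indicE memNset /=; last by move=> /(_ Nw).
    by rewrite mul0r; under eq_fun do rewrite mul0r; exact: cvg_cst.
  apply: cvgMr; apply: contrapT => h; apply: Nw; exact: hN.
move=> _ B mB; rewrite setTI.
apply: (complete_measurable _ ((fun w => \1_(~` N) w * f w) @^-1` B) N) => //.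
  by rewrite -[_ @^-1` _]setTI; exact: mg.
move=> w h; apply: contrapT => Nw; move: h.
by rewrite /setU /setD /preimage /= indicE mem_set// mul1r => -[] [].
Qed.

(** * Discretisation from the right of a bounded stopping time *)

Section fixed_stopping_time.
Variables (theta : R) (tau : Omega -> R).
Hypothesis theta0 : 0 < theta.
Hypothesis stau : stopping_times_upto (usual_augmentation P X) theta tau.

Let tau_itv w : 0 <= tau w <= theta.
Proof. by case: stau. Qed.

(** The complement [tau < t] is the union of the events [tau <= t - 1 / (m + 1)]. Each belongs to
    the augmentation at a time before [t], hence to the natural filtration at [t] up to a null
    set. *)
Lemma stopping_event t : 0 <= t -> exists A, natural_filtration X t A /\
  exists N, null_event P N /\
    ([set w | t <= tau w] `\` A) `|` (A `\` [set w | t <= tau w]) `<=` N.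
Proof.
rewrite le_eqVlt => /predU1P[<-|t0].
  have sT : natural_filtration X 0 setT by exact: (@measurableT _ (g_sigma_algebraType _)).
  exists setT; split => //; exists set0; split; first by split.
  by move=> w [[//]|[_]] /=; case/andP: (tau_itv w) => ->.
have /choice[B hB] : forall m : nat, exists BN : set Omega * set Omega,
    [/\ natural_filtration X t BN.1, null_event P BN.2 &
    ([set w | tau w <= t - m.+1%:R^-1] `\` BN.1) `|`
    (BN.1 `\` [set w | tau w <= t - m.+1%:R^-1]) `<=` BN.2].
  move=> m; have [q0|q0] := leP 0 (t - m.+1%:R^-1).
    have [|B [FB [N [nN hN]]]] := stau.1 _ q0 t; last by exists (B, N).
    by rewrite ltrBlDr ltrDl invr_gt0.
  (* At a negative time the event is empty, because [tau >= 0]. *)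
  exists (set0, set0); split => /=.
  - exact: (@measurable0 _ (g_sigma_algebraType _)).
  - by split.
  - move=> w [[/= h1 _]|[]//]; case/andP: (tau_itv w) => h2 _.
    by have := le_lt_trans (le_trans h2 h1) q0; rewrite ltxx.
exists (~` \bigcup_m (B m).1); split.
  apply: (@measurableC _ (g_sigma_algebraType _)).
  by apply: (@bigcupT_measurable _ (g_sigma_algebraType _)) => m; case: (hB m).
exists (\bigcup_m (B m).2); split.
  have mN : measurable (\bigcup_m (B m).2).
    by apply: bigcupT_measurable => m; case: (hB m) => _ [].
  split => //; apply/negligibleP => //; apply: negligible_bigcup => m.
  by case: (hB m) => _ [mNm PN] _; exact/negligibleP.
move=> w [[/= tw /contrapT [m _ Bm]]|[/= Bw /negP]].
  exists m => //; have [_ _] := hB m; apply; right; split => //=.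
  by apply/negP; rewrite -ltNge (lt_le_trans _ tw)// ltrBlDr ltrDl invr_gt0.
rewrite -ltNge -subr_gt0 => tw.
have [m] := ltr_add_invr tw; rewrite add0r => hm.
exists m => //; have [_ _] := hB m; apply; left; split => /=.
  by rewrite lerBrDr -lerBrDl ltW.
by move=> Bm; apply: Bw; exists m.
Qed.

Lemma measurable_stopping_event t : 0 <= t -> measurable [set w | t <= tau w].
Proof.
move=> t0; have [A [FA [N [nN h]]]] := stopping_event t t0.
by apply: (complete_measurable _ A N) => //; exact: natural_filtration_measurable FA.
Qed.

Let h n : R := theta / n.+1%:R.

Let h0 n : 0 < h n. Proof. by rewrite divr_gt0. Qed.

Let tauh n w : tau w <= n.+1%:R * h n.
Proof. by rewrite /h mulrC divfK//; case/andP: (tau_itv w). Qed.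

Let tau0 w : 0 <= tau w. Proof. by case/andP: (tau_itv w). Qed.

Let mev n k : measurable [set w | k%:R * h n <= tau w].
Proof. by apply: measurable_stopping_event; rewrite mulr_ge0// ltW. Qed.

Let evE n k w : (k%:R * h n <= tau w)%R%:R = \1_[set w | k%:R * h n <= tau w] w :> R.
Proof.
rewrite indicE; congr (nat_of_bool _)%:R.
by apply/idP/idP => [?|]; [exact: mem_set|rewrite inE].
Qed.

Let tau_n n w := roundup (h n) (tau w).

Let cvg_h : h n @[n --> \oo] --> 0.
Proof.
by rewrite -(mulr0 theta); apply: cvgMr; exact: cvg_harmonic.
Qed.

Let cvg_tau_n w : tau_n n w @[n --> \oo] --> tau w.
Proof.
apply: (@squeeze_cvgr _ _ _ _ (fun=> tau w) (fun n => tau w + h n)).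
- by apply: nearW => n; case/andP: (roundup_itv _ _ (h0 n) (tau0 w)) => /ltW -> ->.
- exact: cvg_cst.
- by rewrite -[X in _ --> X]addr0; apply: cvgD => //; exact: cvg_cst.
Qed.

Let tau_nE n w : tau_n n w = \sum_(k < n.+2) \1_[set w | k%:R * h n <= tau w] w * h n.
Proof.
by rewrite /tau_n (roundupE _ _ n.+1)//; apply: eq_bigr => k _; rewrite evE.
Qed.

Let bounded_measurable_tau_n n : bounded_measurable (tau_n n).
Proof.
have -> : tau_n n = fun w => \sum_(k < n.+2) \1_[set w | k%:R * h n <= tau w] w * h n.
  by apply/funext => w; rewrite tau_nE.
apply: bounded_measurable_sum => k; apply: bounded_measurableM.
  exact: bounded_measurable_indic.
exact: bounded_measurable_cst.
Qed.

Lemma bounded_measurable_stopping_time : bounded_measurable tau.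
Proof.
split; last by exists theta => w; rewrite ger0_norm//; case/andP: (tau_itv w).
apply: (@measurable_fun_cvg _ _ _ setT tau_n) => [n|w _]; last exact: cvg_tau_n.
by case: (bounded_measurable_tau_n n).
Qed.

Let sample_nE (g : R -> R) n w : g (X (tau_n n w) w) = g (X 0 w) +
  \sum_(k < n.+2) \1_[set w | k%:R * h n <= tau w] w *
    (g (X (k%:R * h n + h n) w) - g (X (k%:R * h n) w)).
Proof.
rewrite /tau_n (sampleE (fun t => g (X t w)) _ _ n.+1)//; congr (_ + _).
by apply: eq_bigr => k _; rewrite evE -natr1 mulrDl mul1r.
Qed.

Let measurable_sample n : measurable_fun setT (fun w => X (tau_n n w) w).
Proof.
under eq_fun do rewrite (sample_nE id) /=.
apply: measurable_funD => //; apply: measurable_sum => k.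
by apply: measurable_funM; [exact: measurable_indic|exact: measurable_funB].
Qed.

Let cvg_sample : {ae P, forall w, X (tau_n n w) w @[n --> \oo] --> X (tau w) w}.
Proof.
have [_ _ _ _] := levyX; apply: filterS => w [rc _].
have /cvg_at_rightP := rc (tau w) (tau0 w); apply; split; last exact: cvg_tau_n.
by move=> n; case/andP: (roundup_itv _ _ (h0 n) (tau0 w)).
Qed.

(** Right-continuity of the paths holds almost surely, so [X_tau] is an almost sure limit of samples
    and completeness gives its measurability. *)
Lemma measurable_stopped : measurable_fun setT (fun w => X (tau w) w).
Proof. exact: ae_cvg_measurable cvg_sample. Qed.

(* A Dynkin-type bound: the discretisations of [tau] from the right are
   decided by [natural_filtration] before each increment. *)
Lemma mean_cos_stopped_le (u a C : R) : 0 <= C ->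
  (forall s, 0 < s -> `|E (fun w => cos (u * X s w)) - 1| +
     `|E (fun w => sin (u * X s w))| <= C * s) ->
  `|E (fun w => cos (u * X (tau w) w + a)) - cos a| <= C * E tau.
Proof.
move=> C0 hC.
have mc (Y : Omega -> R) : measurable_fun setT Y ->
    measurable_fun setT (fun w => u * Y w + a).
  by move=> mY; apply: measurable_funD => //; exact: measurable_funM.
have bc (Y : Omega -> R) : measurable_fun setT Y ->
    bounded_measurable (fun w => cos (u * Y w + a)).
  by move=> mY; apply: bounded_measurable_cos; exact: mc.
have step n : `|E (fun w => cos (u * X (tau_n n w) w + a)) - cos a| <=
    C * E tau + C * h n.
  have -> : (fun w => cos (u * X (tau_n n w) w + a)) = (fun w =>
      cos (u * X 0 w + a) +
      \sum_(k < n.+2) \1_[set w | k%:R * h n <= tau w] w *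
        (cos (u * X (k%:R * h n + h n) w + a) - cos (u * X (k%:R * h n) w + a))).
    by apply/funext => w; rewrite (sample_nE (fun x => cos (u * x + a))).
  have bt (A : set Omega) k : measurable A -> bounded_measurable (fun w => \1_A w *
        (cos (u * X (k%:R * h n + h n) w + a) - cos (u * X (k%:R * h n) w + a))).
    move=> mA; apply: bounded_measurableM; first exact: bounded_measurable_indic.
    by apply: bounded_measurableB; exact: bc.
  rewrite meanD//; [|exact: bc|by apply: bounded_measurable_sum => k; exact: bt].
  have -> : E (fun w => cos (u * X 0 w + a)) = cos a.
    rewrite -[RHS](mean_cst P); apply: ae_eq_mean; first exact: bc.
      exact: bounded_measurable_cst.
    by apply: filterS X0 => w ->; rewrite mulr0 add0r.
  rewrite [X in `|X|](addrAC (cos a)) subrr add0r mean_sum; last by move=> k; exact: bt.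
  (* Rounding up adds at most [h n] to [tau], an error that vanishes in the limit. *)
  apply: (@le_trans _ _ (C * E (tau_n n))); last first.
    rewrite -mulrDr ler_wpM2l// -[X in _ <= _ + X](mean_cst P) -meanD; last 2 first.
    - exact: bounded_measurable_stopping_time.
    - exact: bounded_measurable_cst.
    apply: le_mean => //.
      apply: bounded_measurableD; first exact: bounded_measurable_stopping_time.
      exact: bounded_measurable_cst.
    by move=> w; case/andP: (roundup_itv _ _ (h0 n) (tau0 w)).
  have -> : tau_n n =
      fun w => \sum_(k < n.+2) \1_[set w | k%:R * h n <= tau w] w * h n.
    by apply/funext => w; rewrite tau_nE.
  have bi k : bounded_measurable (\1_[set w | k%:R * h n <= tau w] : Omega -> R).
    exact: bounded_measurable_indic.
  rewrite mean_sum; last first.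
    by move=> k; apply: bounded_measurableM => //; exact: bounded_measurable_cst.
  rewrite mulr_sumr (le_trans (ler_norm_sum _ _ _))//; apply: ler_sum => k _.
  have kh0 : 0 <= k%:R * h n by rewrite mulr_ge0// ltW.
  (* The event [k h <= tau] is exchanged for a version in the natural filtration, to which the
     one-step bound applies. *)
  have [A [FA [N [[mN PN] hN]]]] := stopping_event _ kh0.
  have mA := natural_filtration_measurable _ _ FA.
  have eqA : {ae P, forall w, \1_[set w | k%:R * h n <= tau w] w = \1_A w :> R}.
    exists N; split => // w /= ne; apply: hN; apply: contrapT => h'; apply: ne.
    rewrite !indicE; congr (nat_of_bool _)%:R; apply/idP/idP; rewrite !inE => h1.
      by apply: contrapT => h2; apply: h'; left.
    by apply: contrapT => h2; apply: h'; right.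
  rewrite (@ae_eq_mean _ _ _ P _ (fun w => \1_A w *
        (cos (u * X (k%:R * h n + h n) w + a) - cos (u * X (k%:R * h n) w + a))));
    [|exact: bt|exact: bt|by apply: filterS eqA => w ->].
  have bA : bounded_measurable (\1_A : Omega -> R) by exact: bounded_measurable_indic.
  have -> : E (fun w => \1_[set w | k%:R * h n <= tau w] w * h n) =
      E (\1_A : Omega -> R) * h n.
    transitivity (E (fun w => h n * \1_A w)); last by rewrite meanZ// mulrC.
    apply: ae_eq_mean.
    - by apply: bounded_measurableM => //; exact: bounded_measurable_cst.
    - by apply: bounded_measurableM => //; exact: bounded_measurable_cst.
    - by apply: filterS eqA => w ->; rewrite mulrC.
  apply: le_trans (mean_cos_increment_le _ _ u a _ kh0 (h0 n) FA) _.
  rewrite mulrCA; apply: ler_wpM2l; last exact: hC.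
  by apply: Rintegral_ge0 => w _; rewrite /indic ler0n.
have cv : `|E (fun w => cos (u * X (tau_n n w) w + a)) - cos a| - C * h n
    @[n --> \oo] --> `|E (fun w => cos (u * X (tau w) w + a)) - cos a| - C * 0.
  apply: cvgB; last exact: cvgMr.
  apply: cvg_norm; apply: cvgB; last exact: cvg_cst.
  apply: (mean_cvg P (fun n w => cos (u * X (tau_n n w) w + a)) _ 1).
  - by move=> n; case: (bc _ (measurable_sample n)).
  - by case: (bc _ measurable_stopped).
  - by move=> n w; exact: cos_max.
  - apply: filterS cvg_sample => w cw; apply: continuous_cvg.
      exact: continuous_cos.
    by apply: cvgD; [apply: cvgMr|exact: cvg_cst].
rewrite mulr0 subr0 in cv; apply: (cvgn_le _ _ _ cv).
by apply: nearW => n; rewrite lerBlDr; exact: step.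
Qed.

End fixed_stopping_time.
End stopped_process.

(** * The characteristic exponent *)

Section levy_khintchine_exponent.
Context {R : realType} (sigma gamma : R) (nu : {measure set R -> \bar R}).
Hypothesis levynu : levy_measure nu.

Lemma measurable_min_sqr : measurable_fun setT (fun x : R => Num.min 1 (x ^+ 2)).
Proof. by apply: measurable_minr => //; exact: measurable_funX. Qed.

Lemma min_sqr_ge0 (x : R) : 0 <= Num.min 1 (x ^+ 2).
Proof. by rewrite le_min ler01 sqr_ge0. Qed.

Lemma integrable_min_sqr (c : R) :
  nu.-integrable setT (EFin \o (fun x => c * Num.min 1 (x ^+ 2))).
Proof.
suff h : nu.-integrable setT (EFin \o (fun x => Num.min 1 (x ^+ 2))).
  have := integrableZl measurableT c h; exact: eq_integrable.
apply/integrableP; split; first by apply/measurable_EFinP; exact: measurable_min_sqr.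
case: levynu => _; under eq_integral => x _.
  by rewrite -(ger0_norm (min_sqr_ge0 x)); over.
by [].
Qed.

Lemma levy_integrable (f : R -> R) (c : R) : measurable_fun setT f ->
  (forall x, `|f x| <= c * Num.min 1 (x ^+ 2)) -> nu.-integrable setT (EFin \o f).
Proof.
move=> mf fc; apply: (le_integrable measurableT) (integrable_min_sqr c).
  exact/measurable_EFinP.
by move=> x _ /=; rewrite lee_fin (le_trans (fc x))// ler_norm.
Qed.

Lemma levy_Rintegral_le (f : R -> R) (c : R) : measurable_fun setT f ->
  (forall x, `|f x| <= c * Num.min 1 (x ^+ 2)) ->
  `|Rintegral nu setT f| <= c * Rintegral nu setT (fun x => Num.min 1 (x ^+ 2)).
Proof.
move=> mf fc; have intf := levy_integrable f c mf fc.
rewrite -RintegralZl//; last first.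
  have := integrable_min_sqr 1; apply: eq_integrable => // x _ /=.
  by rewrite mul1r.
apply: le_trans (le_normr_Rintegral measurableT intf) _.
apply: le_Rintegral => //.
  by apply: (levy_integrable _ c) => [|x]; rewrite ?normr_id//; exact: measurableT_comp.
exact: integrable_min_sqr.
Qed.

Lemma measurable_cosZ (u : R) : measurable_fun setT (fun x : R => cos (u * x)).
Proof. by apply: (measurableT_comp measurable_cos); exact: measurable_funM. Qed.

Lemma onem_cos_le_min_sqr (u x : R) :
  1 - cos (u * x) <= (2 + u ^+ 2) * Num.min 1 (x ^+ 2).
Proof.
have := onem_cos_le2 (u * x); have := onem_cos_le_sqr (u * x).
rewrite exprMn; have := sqr_ge0 u; have := sqr_ge0 x.
by rewrite /Num.min; case: ifP => _; nra.
Qed.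

Lemma norm_cosB1_le (u x : R) :
  `|cos (u * x) - 1| <= (2 + u ^+ 2) * Num.min 1 (x ^+ 2).
Proof. by rewrite distrC ger0_norm ?onem_cos_ge0// onem_cos_le_min_sqr. Qed.

(** Inside the unit ball the compensation leaves a second-order remainder; outside, only a sine is
    left. *)
Lemma norm_sin_compensated_le (u x : R) : 0 <= u <= 1 ->
  `|sin (u * x) - (if `|x| <= 1 then u * x else 0)| <= 1 * Num.min 1 (x ^+ 2).
Proof.
move=> /andP[u0 u1]; have x2 : x ^+ 2 = `|x| ^+ 2 by rewrite real_normK ?num_real.
have xn := normr_ge0 x.
case: ifPn => [x1|]; rewrite mul1r.
  rewrite min_r; last by rewrite x2; nra.
  apply: le_trans (norm_sin_sub_le _) _; rewrite exprMn.
  have := sqr_ge0 x; have : u ^+ 2 <= 1 by nra.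
  nra.
rewrite -ltNge subr0 => x1; rewrite min_l; last by rewrite x2; nra.
exact: sin_max.
Qed.

Lemma measurable_sin_compensated (u : R) : measurable_fun setT
  (fun x : R => sin (u * x) - (if `|x| <= 1 then u * x else 0)).
Proof.
apply: measurable_funB.
  by apply: (measurableT_comp measurable_sin); exact: measurable_funM.
apply: measurable_fun_ifT => //.
by apply: measurable_fun_ler => //; exact: measurableT_comp.
Qed.

Lemma integrable_onem_cos (u : R) :
  nu.-integrable setT (EFin \o (fun x => 1 - cos (u * x))).
Proof.
apply: (levy_integrable _ (2 + u ^+ 2)) => [|x].
  by apply: measurable_funB => //; exact: measurable_cosZ.
by rewrite ger0_norm ?onem_cos_ge0// onem_cos_le_min_sqr.
Qed.

Lemma psi_reE (u : R) : - psi_re sigma nu u =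
  sigma ^+ 2 * u ^+ 2 / 2 + Rintegral nu setT (fun x => 1 - cos (u * x)).
Proof.
rewrite /psi_re opprD mulNr opprK; congr (_ + _).
rewrite -[LHS]mulN1r -RintegralZl//; last first.
  apply: (levy_integrable _ (2 + u ^+ 2)) => [|x]; last exact: norm_cosB1_le.
  by apply: measurable_funB => //; exact: measurable_cosZ.
by apply: eq_Rintegral => x _; rewrite mulN1r opprB.
Qed.

Lemma psi_re_le0 (u : R) : psi_re sigma nu u <= 0.
Proof.
rewrite -oppr_ge0 psi_reE addr_ge0//.
  by rewrite divr_ge0// mulr_ge0// sqr_ge0.
by apply: Rintegral_ge0 => x _; exact: onem_cos_ge0.
Qed.

(** The weight [2] reflects that the imaginary part enters both the cosine and the sine estimate in
    [mean_trig_le]. *)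
Lemma psi_bounded : exists2 C : R, 0 <= C & forall u, 0 <= u <= 1 ->
  `|psi_re sigma nu u| + 2 * `|psi_im gamma nu u| <= C.
Proof.
pose m := Rintegral nu setT (fun x => Num.min 1 (x ^+ 2)).
have m0 : 0 <= m by apply: Rintegral_ge0 => x _; exact: min_sqr_ge0.
exists (sigma ^+ 2 + 3 * m + 2 * (`|gamma| + m)).
  have := sqr_ge0 sigma; have := normr_ge0 gamma; lra.
move=> u u01; have /andP[u0 u1] := u01.
have u2 : u ^+ 2 <= 1 by nra.
apply: lerD.
  rewrite /psi_re; apply: le_trans (ler_normD _ _) _; apply: lerD.
    rewrite mulNr normrN ger0_norm; have := sqr_ge0 sigma; have := sqr_ge0 u; nra.
  apply: le_trans (levy_Rintegral_le _ (2 + u ^+ 2) _ _) _.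
  - by apply: measurable_funB => //; exact: measurable_cosZ.
  - by move=> x; exact: norm_cosB1_le.
  - by rewrite -/m; nra.
rewrite ler_pM2l// /psi_im; apply: le_trans (ler_normD _ _) _; apply: lerD.
  by rewrite normrM (ger0_norm u0); have := normr_ge0 gamma; nra.
rewrite -[m]mul1r; apply: levy_Rintegral_le => [|x].
  exact: measurable_sin_compensated.
exact: norm_sin_compensated_le.
Qed.

Lemma mean_lacunary_nu (N : nat) :
  nu.-integrable setT (EFin \o lacunary_sum N) /\
  Rintegral nu setT (lacunary_sum N) =
  \sum_(k < N) 2 ^- k * Rintegral nu setT (fun x => 1 - cos (2 ^+ k * x)).
Proof.
elim: N => [|N [iN EN]].
  have -> : lacunary_sum 0 = fun _ : R => 0.
    by apply/funext => x; rewrite /lacunary_sum big_ord0.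
  by rewrite big_ord0; split; [exact: integrable0|rewrite /Rintegral integral0].
have -> : lacunary_sum N.+1 = fun x : R =>
    lacunary_sum N x + 2 ^- N * (1 - cos (2 ^+ N * x)).
  by apply/funext => x; rewrite /lacunary_sum big_ord_recr.
have i1 : nu.-integrable setT (EFin \o fun x => 2 ^- N * (1 - cos (2 ^+ N * x))).
  have := integrableZl measurableT (2 ^- N) (integrable_onem_cos (2 ^+ N)).
  exact: eq_integrable.
split; last first.
  rewrite big_ord_recr/= RintegralD// EN RintegralZl//.
  exact: integrable_onem_cos.
have := integrableD measurableT iN i1.
exact: eq_integrable.
Qed.

Lemma sum_psi_re_ge_lacunary (N : nat) :
  Rintegral nu setT (lacunary_sum N) <=
  \sum_(k < N) 2 ^- k * - psi_re sigma nu (2 ^+ k).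
Proof.
have [_ ->] := mean_lacunary_nu N; apply: ler_sum => k _.
rewrite ler_wpM2l ?invr_ge0 ?exprn_ge0// psi_reE lerDr.
by rewrite divr_ge0// mulr_ge0// sqr_ge0.
Qed.

(** If the small jumps have infinite variation, a bound [B] on all the sums would bound by [16 B]
    the integral of [|x|] over each shell [D N], against monotone convergence. If [sigma] is
    nonzero, the last term alone, at least [sigma^2 2^n / 2] for [N = n + 1], is unbounded. *)
Lemma sum_psi_re_unbounded :
  sigma != 0 \/ (\int[nu]_(x in [set x : R | (`|x| <= 1)%R]) (`|x|)%:E = +oo)%E ->
  forall B : R, exists N, B <= \sum_(k < N) 2 ^- k * - psi_re sigma nu (2 ^+ k).
Proof.
move=> [s0|nuoo] B; last first.
  apply: contrapT => /forallNP hB.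
  have {}hB N : \sum_(k < N) 2 ^- k * - psi_re sigma nu (2 ^+ k) <= B.
    by move/negP: (hB N); rewrite -ltNge => /ltW.
  (* The shells increase to the punctured unit ball, and [lacunary_sum N.+1] is at least [|x| / 16]
     on [D N]. *)
  pose D N : set R := [set x | 2 ^- N <= `|x| <= 1].
  have mD N : measurable (D N).
    rewrite (_ : D N = [set x | 2 ^- N <= `|x|] `&` [set x | `|x| <= 1]).
      apply: measurableI.
        by rewrite -[X in measurable X]setTI; apply: measurable_fun_le => //; exact: measurableT_comp.
      by rewrite -[X in measurable X]setTI; apply: measurable_fun_le => //; exact: measurableT_comp.
    by apply/seteqP; split => x /= => [/andP[]//|[h1 h2]]; apply/andP.
  pose g N (x : R) : \bar R := (\1_(D N) x * `|x|)%:E.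
  have mg N : measurable_fun setT (g N).
    apply/measurable_EFinP; apply: measurable_funM; first exact: measurable_indic.
    exact: normr_measurable.
  have gB N : (\int[nu]_x g N x <= (16 * B)%:E)%E.
    have [iN _] := mean_lacunary_nu N.+1.
    apply: (@le_trans _ _ (\int[nu]_x (16%:E * (lacunary_sum N.+1 x)%:E))%E).
      apply: ge0_le_integral => //.
      - by move=> x _; rewrite lee_fin mulr_ge0// /indic ler0n.
      - by apply: emeasurable_funM => //; case/integrableP: iN.
      - move=> x _; rewrite -EFinM lee_fin indicE.
        case: (boolP (x \in D N)) => [|_].
          by rewrite inE mul1r => /lacunary_sum_ge; lra.
        by rewrite mul0r mulr_ge0// lacunary_sum_ge0.
    rewrite integralZl// EFinM lee_pmul2l//.
    have -> : (\int[nu]_x (lacunary_sum N.+1 x)%:E)%E =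
        (Rintegral nu setT (lacunary_sum N.+1))%:E.
      by rewrite fineK//; exact: integrable_fin_num.
    by rewrite lee_fin (le_trans (sum_psi_re_ge_lacunary _))// hB.
  have : (\int[nu]_(x in [set x : R | (`|x| <= 1)%R]) (`|x|)%:E <= (16 * B)%:E)%E.
    have cvg : (\int[nu]_x g N x @[N --> \oo] -->
      \int[nu]_x limn (g ^~ x))%E.
      apply: cvg_monotone_convergence => //.
      - by move=> n x _; rewrite lee_fin mulr_ge0// /indic ler0n.
      - move=> x _ m n mn; rewrite lee_fin ler_wpM2r// !indicE ler_nat.
        case: (boolP (x \in D m)) => //; rewrite inE /D /= => /andP[h1 h2].
        rewrite mem_set//= /D /= h2 andbT (le_trans _ h1)//.
        by rewrite lef_pV2 ?posrE ?exprn_gt0// ler_eXn2l// ltr1n.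
    have -> : (\int[nu]_(x in [set x : R | (`|x| <= 1)%R]) (`|x|)%:E =
      \int[nu]_x limn (g ^~ x))%E.
      rewrite integral_mkcond; apply: eq_integral => x _.
      apply/esym; apply: (cvg_lim (@ereal_hausdorff R)).
      rewrite patchE; case: ifPn => [|x1].
        rewrite inE /= => x1; have [->|x0] := eqVneq x 0.
          apply: cvg_near_cst; apply: nearW => n.
          by rewrite /g normr0 mulr0.
        apply: cvg_near_cst; near=> n; rewrite /g indicE mem_set ?mul1r//.
        rewrite /D /= x1 andbT -exprVn; near: n.
        have /cvgr0_norm_lt : (2^-1 : R) ^+ n @[n --> \oo] --> 0.
          by apply: cvg_expr; rewrite ger0_norm ?invf_lt1// ltr1n.
        move=> /(_ `|x|); rewrite normr_gt0 => /(_ x0); apply: filterS => n /ltW.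
        by rewrite ger0_norm// exprn_ge0.
      apply: cvg_near_cst; apply: nearW => n; rewrite /g indicE memNset ?mul0r// => /andP[_ h].
      by move: x1; rewrite mem_set.
    have cvg' := cvg_lim (@ereal_hausdorff R) cvg.
    rewrite -cvg'; apply: lime_le; first exact: cvgP cvg.
    by apply: nearW.
  by rewrite nuoo.
have sp : 0 < sigma ^+ 2 by rewrite exprn_even_gt0.
(* Combined with [n <= 2^n], this gives [B <= sigma^2 2^n / 2]. *)
have [n hn] : exists n : nat, 2 * B / sigma ^+ 2 <= n%:R.
  by exists (Num.truncn (2 * B / sigma ^+ 2)).+1; rewrite ltW// truncnS_gt.
exists n.+1; rewrite big_ord_recr/=.
rewrite -[leLHS]add0r lerD//.
  apply: sumr_ge0 => k _; rewrite mulr_ge0 ?invr_ge0 ?exprn_ge0// oppr_ge0.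
  exact: psi_re_le0.
rewrite psi_reE.
have I0 : 0 <= Rintegral nu setT (fun x => 1 - cos (2 ^+ n * x)).
  by apply: Rintegral_ge0 => x _; exact: onem_cos_ge0.
have p0 : 0 < (2 ^+ n : R) by rewrite exprn_gt0.
rewrite mulrDr -[leLHS]addr0 lerD//; last by rewrite mulr_ge0// invr_ge0 ltW.
have -> : 2 ^- n * (sigma ^+ 2 * (2 ^+ n) ^+ 2 / 2) = sigma ^+ 2 * 2 ^+ n / 2.
  by field; rewrite lt0r_neq0.
have n2 : (n%:R : R) <= 2 ^+ n by rewrite -natrX ler_nat ltnW// ltn_expl.
move: hn; rewrite ler_pdivrMr// => hn.
have : n%:R * sigma ^+ 2 <= 2 ^+ n * sigma ^+ 2 by rewrite ler_pM2r.
lra.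
Unshelve. all: by end_near. Qed.

End levy_khintchine_exponent.

(** * Bounds on the American put *)

Section american_put_bounds.
Context {R : realType} {d : measure_display} {Omega : measurableType d}
  (P : probability Omega R) (X : R -> Omega -> R)
  (sigma gamma : R) (nu : {measure set R -> \bar R}).
Hypothesis complP : complete_probability P.
Hypothesis levyX : levy_process P X.
Hypothesis tripX : has_triplet P X sigma gamma nu.
Local Notation E f := (Rintegral P setT f).

Let mX t : measurable_fun setT (X t).
Proof. by case: levyX. Qed.

Let levynu : levy_measure nu.
Proof. by case: tripX. Qed.

Lemma bounded_measurable_put (s : R) :
  bounded_measurable (fun w => Num.max (1 - expR (X s w)) 0).
Proof.
split.
  apply: measurable_maxr => //; apply: measurable_funB => //.
  exact: (measurableT_comp (@measurable_expR R)).
exists 1 => w; rewrite ger0_norm; last by rewrite le_max lexx orbT.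
by rewrite ge_max ler01 andbT; have := expR_ge0 (X s w); lra.
Qed.

(** The characteristic function is [exp (s psi)] with [Re psi <= 0], so its modulus differs from [1]
    by at most [s |Re psi|], and its phase contributes at most [s |Im psi|] to each of the two
    terms. *)
Lemma mean_trig_le : exists2 C : R, 0 <= C & forall u, 0 <= u <= 1 ->
  forall s, 0 < s -> `|E (fun w => cos (u * X s w)) - 1| +
     `|E (fun w => sin (u * X s w))| <= C * s.
Proof.
have [C C0 hC] := psi_bounded sigma gamma nu levynu.
exists C => // u u01 s s0; have [_ /(_ s u (ltW s0))[-> ->]] := tripX.
have := hC u u01; have := psi_re_le0 sigma nu levynu u.
set p := psi_re _ _ _; set q := psi_im _ _ _ => p0 pq.
have e1 : expR (s * p) <= 1 by rewrite -expR0 ler_expR; nra.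
have e2 : 1 + s * p <= expR (s * p) by exact: expR_ge1Dx.
have e0 := expR_ge0 (s * p).
have sq : `|s * q| = s * `|q| by rewrite normrM gtr0_norm.
rewrite (ler0_norm p0) in pq.
have h1 : `|expR (s * p) * cos (s * q) - 1| <= s * (- p) + s * `|q|.
  have -> : expR (s * p) * cos (s * q) - 1 =
    - ((1 - expR (s * p)) + expR (s * p) * (1 - cos (s * q))) by ring.
  have := onem_cos_le_norm (s * q); have := onem_cos_ge0 (s * q); rewrite sq => c0 c1.
  rewrite normrN ger0_norm; nra.
have h2 : `|expR (s * p) * sin (s * q)| <= s * `|q|.
  rewrite normrM (ger0_norm e0).
  have := norm_sin_le (s * q); rewrite sq; have := normr_ge0 (sin (s * q)); nra.
have : s * (- p + 2 * `|q|) <= s * C by rewrite ler_pM2l.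
lra.
Qed.

(** The Dynkin-type bound is used with phase [- pi / 2], which turns the cosine into a sine, and
    with phase [0] for all [u] in [[0, 1]], as [mean_min_sqr_le] requires. *)
Lemma mean_stopped_le : exists2 C : R, 0 <= C & forall theta tau, 0 < theta ->
  stopping_times_upto (usual_augmentation P X) theta tau ->
  - (C * E tau) <= E (fun w => sin (X (tau w) w)) /\
  E (fun w => Num.min 1 (X (tau w) w ^+ 2)) <= 32 * (C * E tau).
Proof.
have [C C0 hC] := mean_trig_le; exists C => // theta tau theta0 stau.
have mXt := measurable_stopped P X complP levyX _ _ theta0 stau.
have hc u a := mean_cos_stopped_le P X complP levyX _ _ theta0 stau u a C C0.
split.
  have := hc 1 (- (pi / 2)) (hC 1 _); rewrite ler01 lexx => /(_ isT).
  rewrite cosN cos_pihalf subr0.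
  have -> : (fun w => cos (1 * X (tau w) w + - (pi / 2))) = (fun w => sin (X (tau w) w)).
    by apply/funext => w; rewrite mul1r cosBpihalf.
  by rewrite ler_norml => /andP[].
apply: mean_min_sqr_le => // u u01.
have := hc u 0 (hC u u01); rewrite cos0.
under eq_Rintegral do rewrite addr0.
rewrite meanB ?mean_cst; last 2 first.
- exact: bounded_measurable_cst.
- by apply: bounded_measurable_cos; exact: measurable_funM.
by rewrite distrC; apply: le_trans; exact: ler_norm.
Qed.

Lemma bounded_measurable_payoff (r delta K x theta : R) (tau : Omega -> R) :
  0 <= r -> 0 <= K -> 0 <= x -> 0 < theta ->
  stopping_times_upto (usual_augmentation P X) theta tau ->
  bounded_measurable (fun w => expR (- (r * tau w)) *
    Num.max (K - price X r delta x (tau w) w) 0).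
Proof.
move=> r0 K0 x0 theta0 stau.
have [mt _] := bounded_measurable_stopping_time P X complP levyX _ _ theta0 stau.
have mXt := measurable_stopped P X complP levyX _ _ theta0 stau.
split.
  apply: measurable_funM.
    apply: (measurableT_comp (@measurable_expR R)).
    by apply: measurableT_comp => //; exact: measurable_funM.
  apply: measurable_maxr => //; apply: measurable_funB => //.
  apply: measurable_funM => //; apply: (measurableT_comp (@measurable_expR R)).
  by apply: measurable_funD => //; exact: measurable_funM.
exists K => w; have [_ /(_ w)/andP[t0 _]] := stau.
have e0 := expR_ge0 (- (r * tau w)).
have e1 : expR (- (r * tau w)) <= 1 by rewrite -expR0 ler_expR; nra.
have p0 : 0 <= price X r delta x (tau w) w by rewrite mulr_ge0// expR_ge0.
have m0 : 0 <= Num.max (K - price X r delta x (tau w) w) 0 by rewrite le_max lexx orbT.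
have m1 : Num.max (K - price X r delta x (tau w) w) 0 <= K by rewrite ge_max; lra.
rewrite ger0_norm; nra.
Qed.

(* With [phi y := 1 + sin y - 2 min(1, y ^ 2) <= expR y], stopping at [tau]
   gains at most [x C E tau] on the underlying, whereas it loses at least
   [c K E tau / 2] in interest on the strike. *)
Lemma american_put_small (r delta K theta : R) :
  0 < r -> delta <= r -> 0 < K -> 0 < theta ->
  exists2 x0 : R, 0 < x0 & forall T t x, T - t = theta -> 0 <= x -> x < x0 ->
    (american_put P X r delta K T t x <= (Num.max (K - x) 0)%:E)%E.
Proof.
move=> r0 rd K0 theta0; have [C C0 hC] := mean_stopped_le.
have rt : 0 < r * theta by rewrite mulr_gt0.
(* Since [1 - e^(-r tau) >= r tau / (1 + r tau)] and [tau <= theta], discounting removes at least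
   the fraction [c tau]. *)
pose c := r / (1 + r * theta).
have c0 : 0 < c by rewrite divr_gt0//; lra.
(* The sine contributes [C] and the term [2 min(1, X^2)] contributes [64 C]; the added [1] makes
   [C'] positive. *)
pose C' := 65 * C + 1; have C'0 : 0 < C' by rewrite /C'; lra.
(* The first bound gives [K - x phi >= K / 2], because [phi <= 2]; the second gives
   [x C' <= K c / 2], so the interest outweighs the gain. *)
pose z0 := Num.min (1 / 4) (c / (2 * C')).
have z00 : 0 < z0.
  rewrite lt_min; apply/andP; split; first lra.
  by rewrite divr_gt0//; lra.
exists (K * z0); first exact: mulr_gt0.
move=> T t x Tt x0 xz.
have xK : x <= K / 4.
  have : z0 <= 1 / 4 by rewrite ge_min lexx.
  nra.
have xC : x * C' <= K * c / 2.
  have : z0 <= c / (2 * C') by rewrite ge_min lexx orbT.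
  rewrite ler_pdivlMr; last lra.
  nra.
have -> : Num.max (K - x) 0 = K - x by apply/max_idPl; lra.
rewrite /american_put Tt; apply: ge_ereal_sup => _ [tau stau <-].
have bpay := bounded_measurable_payoff r delta K x theta tau
  (ltW r0) (ltW K0) x0 theta0 stau.
rewrite -EFin_mean// lee_fin.
have bt := bounded_measurable_stopping_time P X complP levyX _ _ theta0 stau.
have mXt := measurable_stopped P X complP levyX _ _ theta0 stau.
have bs : bounded_measurable (fun w => sin (X (tau w) w)) by exact: bounded_measurable_sin.
have bm : bounded_measurable (fun w => Num.min 1 (X (tau w) w ^+ 2)).
  exact: bounded_measurable_min_sqr.
pose phi w := 1 + sin (X (tau w) w) - 2 * Num.min 1 (X (tau w) w ^+ 2).
have bc (a : R) : bounded_measurable (fun _ : Omega => a) by exact: bounded_measurable_cst.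
have b1 : bounded_measurable (fun w => 1 + sin (X (tau w) w)) by exact: bounded_measurableD.
have b2 : bounded_measurable (fun w => 2 * Num.min 1 (X (tau w) w ^+ 2)).
  exact: bounded_measurableM.
have bphi : bounded_measurable phi by exact: bounded_measurableB.
have b3 : bounded_measurable (fun w => x * phi w) by exact: bounded_measurableM.
have b4 : bounded_measurable (fun w => K * c / 2 * tau w) by exact: bounded_measurableM.
have b5 : bounded_measurable (fun w => K - x * phi w) by exact: bounded_measurableB.
apply: (@le_trans _ _ (E (fun w => K - x * phi w - K * c / 2 * tau w))).
  apply: le_mean => //; first exact: bounded_measurableB.
  move=> w; have [_ /(_ w)/andP[t0 t1]] := stau.
  have phi_le : phi w <= expR (X (tau w) w) by exact: sin_min_sqr_le_expR.
  have phi2 : phi w <= 2.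
    by rewrite /phi; have := sin_le1 (X (tau w) w); have := min_sqr_ge0 (X (tau w) w); lra.
  have S_ge : x * phi w <= price X r delta x (tau w) w.
    rewrite /price; apply: ler_wpM2l => //; apply: le_trans phi_le _.
    by rewrite ler_expR lerDr mulr_ge0// subr_ge0.
  have e0 := expR_ge0 (- (r * tau w)).
  have et : expR (- (r * tau w)) <= 1 - c * tau w.
    have rtau : 0 <= r * tau w by nra.
    have := onemexpRN_ge _ rtau.
    suff : c * tau w <= r * tau w / (1 + r * tau w) by lra.
    rewrite /c mulrAC ler_wpM2l// lef_pV2 ?posrE; nra.
  have xphi : x * phi w <= K / 2 by nra.
  apply: (@le_trans _ _ (expR (- (r * tau w)) * (K - x * phi w))).
    apply: ler_wpM2l => //; rewrite ge_max; apply/andP; split; lra.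
  have ct : 0 <= c * tau w by rewrite mulr_ge0// ltW.
  nra.
have [h1 h2] := hC theta tau theta0 stau.
rewrite meanB// meanB// !meanZ// mean_cst /phi meanB// meanD// mean_cst meanZ//.
have t0 : 0 <= E tau by apply: Rintegral_ge0 => w _; have [_ /(_ w)/andP[]] := stau.
move: h1 h2 t0; set tt := E tau; set s := E (fun w => sin (X (tau w) w)).
set m := E (fun w => Num.min 1 (X (tau w) w ^+ 2)) => h1 h2 t0.
have hs : 1 - (65 * C) * tt <= 1 + s - 2 * m by lra.
have : x * (1 - 65 * C * tt) <= x * (1 + s - 2 * m) by rewrite ler_wpM2l.
have : x * C' * tt <= K * c / 2 * tt by rewrite ler_wpM2r.
rewrite /C'; nra.
Qed.

(** The pointwise bound [lacunary_sum_le_payoff] is integrated at [X s]: the mean of the lacunary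
    sum has an arbitrarily large slope in [s], while the sine and truncated square have a fixed
    one. *)
Lemma mean_european_payoff_ge :
  sigma != 0 \/ (\int[nu]_(x in [set x : R | (`|x| <= 1)%R]) (`|x|)%:E = +oo)%E ->
  forall B : R, exists2 eps : R, 0 < eps & forall s, 0 < s -> s < eps ->
    B * s <= E (fun w => Num.max (1 - expR (X s w)) 0).
Proof.
move=> infvar B; have [C C0 hC] := mean_trig_le.
(* The leading [2] offsets the factor [s / 2] below; subtracting the errors [16 C s] and
   [24 (32 C s)] leaves [40 B s]. *)
have [N hN] := sum_psi_re_unbounded sigma nu levynu infvar
  (2 * (40 * B + 16 * C + 24 * (32 * C))).
pose a k := - psi_re sigma nu (2 ^+ k).
have a0 k : 0 <= a k by rewrite oppr_ge0; exact: psi_re_le0.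
pose A := \sum_(k < N) a k.
have A0 : 0 <= A by apply: sumr_ge0 => k _; exact: a0.
have aA (k : 'I_N) : a k <= A.
  by rewrite /A (bigD1 k)//= lerDl; apply: sumr_ge0 => i _; exact: a0.
(* For such [s] all the products [s a_k] are at most [1], whence [1 - e^(- s a_k) >= s a_k / 2]. *)
exists (1 + A)^-1; first by rewrite invr_gt0; lra.
move=> s s0 sA.
have sA1 : s * A <= 1.
  have : s * (1 + A) < 1 by rewrite -ltr_pdivlMr ?div1r//; lra.
  lra.
have muX (u : R) : measurable_fun setT (fun w => u * X s w) by exact: measurable_funM.
have bcos u : bounded_measurable (fun w => cos (u * X s w)).
  exact: bounded_measurable_cos.
have bc (c : R) : bounded_measurable (fun _ : Omega => c) by exact: bounded_measurable_cst.
have bs : bounded_measurable (fun w => sin (X s w)) by exact: bounded_measurable_sin.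
have bm : bounded_measurable (fun w => Num.min 1 (X s w ^+ 2)).
  exact: bounded_measurable_min_sqr.
have bp : bounded_measurable (fun w => Num.max (1 - expR (X s w)) 0).
  exact: bounded_measurable_put.
have bl k : bounded_measurable (fun w => 2 ^- k * (1 - cos (2 ^+ k * X s w))).
  by apply: bounded_measurableM => //; exact: bounded_measurableB.
have blac : bounded_measurable (fun w => lacunary_sum N (X s w)).
  by apply: bounded_measurable_sum => k; exact: bl.
have lower : s / 2 * (2 * (40 * B + 16 * C + 24 * (32 * C))) <=
    E (fun w => lacunary_sum N (X s w)).
  apply: (@le_trans _ _ (s / 2 * \sum_(k < N) 2 ^- k * a k)).
    by rewrite ler_wpM2l//; lra.
  rewrite mean_sum; last by move=> k; exact: bl.
  rewrite mulr_sumr; apply: ler_sum => k _.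
  rewrite meanZ; last exact: bounded_measurableB.
  rewrite mulrCA ler_wpM2l ?invr_ge0 ?exprn_ge0// meanB// mean_cst.
  have [_ /(_ s (2 ^+ k) (ltW s0))[-> _]] := tripX.
  have ak := a0 k; have sak : s * a k <= 1 by have := aA k; nra.
  have sak0 : 0 <= s * a k by rewrite mulr_ge0// ltW.
  have -> : s * psi_re sigma nu (2 ^+ k) = - (s * a k) by rewrite /a mulrN opprK.
  (* The phase can only help, as [e^(- s a_k) cos q <= e^(- s a_k)]. *)
  set q := s * psi_im _ _ _.
  have := onemexpRN_ge _ sak0; have := expR_ge0 (- (s * a k)); have := cos_le1 q.
  have : s * a k / 2 <= s * a k / (1 + s * a k).
    by rewrite ler_wpM2l// lef_pV2 ?posrE; lra.
  nra.
have msin : E (fun w => sin (X s w)) <= C * s.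
  have := hC 1 _ s s0; rewrite ler01 lexx => /(_ isT).
  have -> : (fun w => sin (1 * X s w)) = (fun w => sin (X s w)).
    by apply/funext => w; rewrite mul1r.
  have := ler_norm (E (fun w => sin (X s w))).
  have := normr_ge0 (E (fun w => cos (1 * X s w)) - 1); lra.
have mmin : E (fun w => Num.min 1 (X s w ^+ 2)) <= 32 * (C * s).
  apply: mean_min_sqr_le => // u u01; rewrite meanB// mean_cst.
  have := hC u u01 s s0; have := ler_norm (1 - E (fun w => cos (u * X s w))).
  rewrite distrC; have := normr_ge0 (E (fun w => sin (u * X s w))); lra.
have b1 : bounded_measurable (fun w => 40 * Num.max (1 - expR (X s w)) 0).
  exact: bounded_measurableM.
have b2 : bounded_measurable (fun w => 16 * sin (X s w)) by exact: bounded_measurableM.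
have b3 : bounded_measurable (fun w => 24 * Num.min 1 (X s w ^+ 2)).
  exact: bounded_measurableM.
have b12 : bounded_measurable
    (fun w => 40 * Num.max (1 - expR (X s w)) 0 + 16 * sin (X s w)).
  exact: bounded_measurableD.
have : E (fun w => lacunary_sum N (X s w)) <=
    E (fun w => 40 * Num.max (1 - expR (X s w)) 0 + 16 * sin (X s w) +
      24 * Num.min 1 (X s w ^+ 2)).
  apply: le_mean => //; first exact: bounded_measurableD.
  by move=> w; exact: lacunary_sum_le_payoff.
rewrite meanD// meanD// !meanZ//; nra.
Qed.

Lemma stopping_time_cst (theta : R) : 0 <= theta ->
  stopping_times_upto (usual_augmentation P X) theta (fun=> theta).
Proof.
move=> theta0; split; last by move=> w; rewrite theta0 lexx.
move=> t t0 u tu; exists [set w | theta <= t]; split; last first.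
  by exists set0; split; [split|move=> w [[]|[]]].
have [h|h] := boolP (theta <= t).
  rewrite (_ : [set _ | _] = setT); last by apply/seteqP; split.
  exact: (@measurableT _ (g_sigma_algebraType _)).
rewrite (_ : [set _ | _] = set0); last by apply/seteqP; split => // w /=; apply/negP.
exact: (@measurable0 _ (g_sigma_algebraType _)).
Qed.

(** Exercise at maturity is worth at least [K / 2] times the mean of [(1 - e^X)_+], which exceeds
    [K M (T - t) >= K - x] close to maturity. *)
Lemma american_put_large (r delta K M : R) :
  sigma != 0 \/ (\int[nu]_(x in [set x : R | (`|x| <= 1)%R]) (`|x|)%:E = +oo)%E ->
  0 < r -> 0 <= delta <= r -> 0 < K -> 0 < M -> 2 * (r - delta) <= M ->
  exists2 eps : R, 0 < eps & forall T t, 0 < T - t -> T - t < eps ->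
    ((Num.max (K - K / (1 + M * (T - t))) 0)%:E <
     american_put P X r delta K T t (K / (1 + M * (T - t))))%E.
Proof.
move=> infvar r0 /andP[d0 rd] K0 M0 rdM.
(* The slope [2 M + 1] survives the factor [1 / 2] lost to discounting with a strict margin over
   [M]. *)
have [e1 e10 he1] := mean_european_payoff_ge infvar (2 * M + 1).
(* The second bound gives [r th < 1 / 2], hence a discount factor of at least [1 / 2] and
   [(r - delta) th <= 1 / 2]. *)
pose eps := Num.min e1 (1 / (2 * r)).
have eps0 : 0 < eps.
  by rewrite lt_min e10 /= divr_gt0//; lra.
exists eps => // T t; rewrite /american_put; set th := T - t => th0 theps.
set x := K / (1 + M * th).
have [the1 thr] : th < e1 /\ th * (2 * r) < 1.
  move: theps; rewrite /eps lt_min => /andP[h1 h2]; split => //.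
  by move: h2; rewrite ltr_pdivlMr; lra.
have Mt0 : 0 < 1 + M * th by nra.
have x0 : 0 < x by rewrite divr_gt0.
pose z := (1 + M * th)^-1; have z0 : 0 < z by rewrite invr_gt0.
have zM : z * (1 + M * th) = 1 by rewrite mulVf// lt0r_neq0.
have xE : x = K * z by [].
have z1 : z <= 1 by have := mulr_ge0 (ltW z0) (mulr_ge0 (ltW M0) (ltW th0)); lra.
have -> : Num.max (K - x) 0 = K - x by apply/max_idPl; rewrite xE; nra.
have stau := stopping_time_cst th (ltW th0).
have bpay := bounded_measurable_payoff r delta K x th (fun=> th)
  (ltW r0) (ltW K0) (ltW x0) th0 stau.
apply: (@lt_le_trans _ _ (E (fun w => expR (- (r * th)) *
    Num.max (K - price X r delta x th w) 0))%:E); last first.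
  by rewrite EFin_mean//; apply: ereal_sup_ubound; exists (fun=> th).
rewrite lte_fin.
(* As [M >= 2 (r - delta)], the drift cannot carry [x] above [K], and the payoff at maturity
   dominates [K (1 - e^X)_+]. *)
have expz : z * expR ((r - delta) * th) <= 1.
  pose v := (r - delta) * th.
  have v0 : 0 <= v by apply: mulr_ge0; [rewrite subr_ge0|exact: ltW].
  suff : expR v <= 1 + M * th.
    by move=> h; rewrite -zM; apply: ler_wpM2l => //; exact: ltW.
  have v2 : v <= 1 / 2 by rewrite /v; nra.
  (* Follows from [e^(-v) >= 1 - v] and [v <= 1 / 2]. *)
  have : expR v <= 1 + 2 * v.
    have := expR_ge1Dx (- v); have := expRxMexpNx_1 v; have := expR_gt0 v; nra.
  have : 2 * v <= M * th by rewrite /v; nra.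
  lra.
have bp : bounded_measurable (fun w => Num.max (1 - expR (X th w)) 0).
  exact: bounded_measurable_put.
have disc : 1 / 2 <= expR (- (r * th)) by have := expR_ge1Dx (- (r * th)); lra.
apply: (@lt_le_trans _ _ (E (fun w => K / 2 * Num.max (1 - expR (X th w)) 0))); last first.
  apply: le_mean => //.
    by apply: bounded_measurableM => //; exact: bounded_measurable_cst.
  move=> w; have m0 : 0 <= Num.max (1 - expR (X th w)) 0 by rewrite le_max lexx orbT.
  have : K * Num.max (1 - expR (X th w)) 0 <= Num.max (K - price X r delta x th w) 0.
    have pX : price X r delta x th w <= K * expR (X th w).
      rewrite /price expRD xE -mulrA ler_pM2l// mulrA ler_piMl// expR_ge0.
    rewrite {1}/Num.max; case: ifP => _; first by rewrite mulr0 le_max lexx orbT.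
    by rewrite le_max; apply/orP; left; lra.
  set m := Num.max (1 - _) 0 in m0 * => Km.
  have Km0 : 0 <= K * m by rewrite mulr_ge0// ltW.
  apply: (@le_trans _ _ (expR (- (r * th)) * (K * m))); first by nra.
  by rewrite ler_wpM2l// expR_ge0.
rewrite meanZ//; have := he1 th th0 the1.
set p := E _ => hp.
have : K / 2 * ((2 * M + 1) * th) <= K / 2 * p by rewrite ler_wpM2l//; lra.
have : K - x <= K * (M * th).
  have zMt : z * (M * th) <= M * th by rewrite ler_piMl// mulr_ge0// ltW.
  by rewrite xE -[X in X - _]mulr1 -mulrBr ler_pM2l//; lra.
have : 0 < K * th by rewrite mulr_gt0.
nra.
Qed.

End american_put_bounds.

(** * Combination of the two bounds on the critical price *)

Theorem theorem6p1 (R : realType) (d : measure_display) (Omega : measurableType d)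
  (P : probability Omega R) (X : R -> Omega -> R)
  (sigma gamma : R) (nu : {measure set R -> \bar R})
  (T K r delta : R) :
  complete_probability P ->
  levy_process P X ->
  has_triplet P X sigma gamma nu ->
  0 < T -> 0 < K -> 0 < r -> 0 <= delta ->
  (\int[nu]_(x in [set x : R | (1 <= `|x|)%R]) (expR x)%:E < +oo)%E ->
  nu.-integrable setT
    (fun x => (expR x - 1 - (if `|x| <= 1 then x else 0))%:E) ->
  sigma ^+ 2 / 2 + gamma +
    Rintegral nu setT (fun x => expR x - 1 - (if `|x| <= 1 then x else 0)) = 0 ->
  (sigma != 0 \/ (0%E < nu [set x : R | (x < 0)%R])%E \/
     (\int[nu]_(x in [set x : R | (0 < x)%R]) (Num.min x 1)%:E = +oo)%E) ->
  (sigma != 0 \/ (\int[nu]_(x in [set x : R | (`|x| <= 1)%R]) (`|x|)%:E = +oo)%E) ->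
  (0 <= (r - delta)%R%:E - \int[nu]_y (Num.max (expR y - 1) 0)%R%:E)%E ->
  (T - t)^-1 * (K / critical_price P X r delta K T t - 1) @[t --> T^'-] --> +oo.
Proof.
move=> complP levyX tripX T0 K0 r0 d0 _ _ _ _ infvar dplus.
have rd : delta <= r.
  rewrite -subr_ge0 -lee_fin; apply: le_trans dplus _.
  apply: geeDl; rewrite leeNl oppe0; apply: integral_ge0 => y _.
  by rewrite lee_fin le_max lexx orbT.
apply/cvgryPge => A.
(* [M] dominates the threshold [A] and meets the two requirements of [american_put_large]: [M > 0]
   and [M >= 2 (r - delta)]. *)
pose M := Num.max A (Num.max 1 (2 * (r - delta))).
have AM : A <= M by rewrite le_max lexx.
have M0 : 0 < M by rewrite !lt_max ltr01 orbT.
have rdM : 2 * (r - delta) <= M by rewrite !le_max lexx !orbT.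
have d0r : 0 <= delta <= r by rewrite d0.
have [eps eps0 large] := american_put_large P X sigma gamma nu complP levyX tripX
  r delta K M infvar r0 d0r K0 M0 rdM.
near=> t.
have th0 : 0 < T - t by rewrite subr_gt0; near: t; exact: nbhs_left_lt.
have theps : T - t < eps.
  have : T - eps < t; last by lra.
  by near: t; apply: nbhs_left_gt; lra.
have [x0 x00 small] := american_put_small P X sigma gamma nu complP levyX tripX
  r delta K (T - t) r0 rd K0 th0.
have Mt : 0 < 1 + M * (T - t) by rewrite addr_gt0// mulr_gt0.
pose x1 := K / (1 + M * (T - t)).
rewrite /critical_price; set S := [set x : R | _].
have Sx1 : S x1 by split; [rewrite divr_ge0// ltW|exact: large].
(* Here [x0] may depend on [t]: it serves to make the infimum positive. This matters because
   division by zero yields [0], so a zero critical price would ruin the quotient. *)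
have lbS : lbound S x0.
  move=> x [x_ge0 hx]; rewrite leNgt; apply/negP => xx0.
  by have := small T t x erefl x_ge0 xx0; rewrite leNgt hx.
have b0 : x0 <= inf S by apply: lb_le_inf => //; exists x1.
have b1 : inf S <= x1 by apply: ge_inf => //; exists x0.
apply: (le_trans AM); rewrite ler_pdivlMl// lerBrDl.
rewrite ler_pdivlMr; last exact: lt_le_trans b0.
have e : x1 * (1 + M * (T - t)) = K by rewrite divfK// lt0r_neq0.
by have := ler_wpM2r (ltW Mt) b1; rewrite e mulrC [M * _]mulrC.
Unshelve. all: by end_near. Qed.
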